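(* The class $\mathcal F_{\oplus,\otimes}$ of straight-line programs that use only floating-point addition $\oplus$, multiplication $\otimes$, and floating-point constants is floating-point interval-complete: for all $n,m\in\mathbb N$ and every function $P:\mathbb F^n\to(\mathbb F\cup\{-\infty,+\infty\})^m$ (equivalently, every terminating floating-point program taking $n$ finite floats and returning $m$ finite or infinite floats), there exists $Q\in\mathcal F_{\oplus,\otimes}$ with $n$ inputs and $m$ outputs that interval-simulates $P$, i.e., for every abstract box $\mathcal B\in\mathbb I^n$ with $\gamma(\mathcal B)\subseteq\mathbb F^n$, $\gamma(Q^\sharp(\mathcal B))=[\min P(\gamma(\mathcal B)),\max P(\gamma(\mathcal B))]\cap\overline{\mathbb F}$ (min and max taken coordinatewise, the right side being the corresponding product of sets). In particular $Q(\mathbf x)=P(\mathbf x)$ for all $\mathbf x\in\mathbb F^n$.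
   Context: Floating point. Fix integers $E\ge 5$ and $M$ with $2^{E-1}\ge M\ge 3$; let $\mathfrak e_{\min}=-2^{E-1}+2$, $\mathfrak e_{\max}=2^{E-1}-1$. $\mathbb F=\{(-1)^b(s_0.s_1\dots s_M)_2\cdot 2^e: b,s_i\in\{0,1\},e\in\{\mathfrak e_{\min},\dots,\mathfrak e_{\max}\}\}$, $\overline{\mathbb F}=\mathbb F\cup\{-\infty,+\infty,\mathrm{NaN}\}$, $\Omega=2^{\mathfrak e_{\max}}(2-2^{-M})$, $\varepsilon=2^{-M-1}$. $\mathrm{rnd}:\mathbb R\to\overline{\mathbb F}$ is round-to-nearest-ties-to-even (ties toward the float with last significand bit $0$), overflowing to $\pm\infty$ when $|x|\ge\Omega+2^{\mathfrak e_{\max}}\varepsilon$; $x\oplus y=\mathrm{rnd}(x+y)$ and $x\otimes y=\mathrm{rnd}(xy)$ for finite $x,y$, and IEEE-754 semantics for non-finite operands. A straight-line program in $\mathcal F_{\oplus,\otimes}$ with inputs $x_1,\dots,x_n$ is a finite sequence of assignments $v_k:=u\odot u'$, where $\odot\in\{\oplus,\otimes\}$ and each of $u,u'$ is an input, a previously assigned variable, or a constant from $\mathbb F$, together with a designated output tuple of $m$ such terms; its concrete semantics $Q:\mathbb F^n\to\overline{\mathbb F}^m$ is obtained by evaluating the assignments. Intervals: $\mathbb I=\{\langle a,b\rangle:a,b\in\overline{\mathbb F}\setminus\{\mathrm{NaN}\},a\le b\}\cup\{\top\}$, $\gamma(\langle a,b\rangle)=[a,b]\cap\overline{\mathbb F}$,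 $\gamma(\top)=\overline{\mathbb F}$, $\gamma(\mathcal I_1,\dots,\mathcal I_n)=\prod_i\gamma(\mathcal I_i)$. For $\odot\in\{\oplus,\otimes\}$, $\langle a,b\rangle\odot^\sharp\langle c,d\rangle=\langle\min S,\max S\rangle$ with $S=\{a\odot c,a\odot d,b\odot c,b\odot d\}$ if $\mathrm{NaN}\notin S$, and $\top$ if $\mathrm{NaN}\in S$ or either operand is $\top$. The interval semantics $Q^\sharp:\mathbb I^n\to\mathbb I^m$ evaluates the same assignments with $\oplus^\sharp,\otimes^\sharp$ in place of $\oplus,\otimes$ and the singleton interval $\langle c,c\rangle$ in place of each constant $c$. *)

(* Defs.v *)
From Stdlib Require Import Reals ZArith List ClassicalEpsilon.
From mathcomp Require Import ssreflect ssrbool ssrfun eqtype ssrnat fintype.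
Set Implicit Arguments.
Unset Strict Implicit.
Unset Printing Implicit Defensive.

Section Format.
Variables E M : nat.

Definition emin : Z := (- 2 ^ (Z.of_nat E - 1) + 2)%Z.
Definition emax : Z := (2 ^ (Z.of_nat E - 1) - 1)%Z.

(* r is (-1)^b (s_0.s_1...s_M)_2 * 2^e ; the significand bits are encoded by
   the integer mant = (s_0 s_1 ... s_M)_2 in [0, 2^(M+1)). *)
Definition is_repr (r : R) (b : bool) (mant e : Z) : Prop :=
  (0 <= mant < 2 ^ (Z.of_nat M + 1))%Z /\ (emin <= e <= emax)%Z /\
  r = ((if b then (-1) else 1) * IZR mant * powerRZ 2 (e - Z.of_nat M))%R.

Definition in_F (r : R) : Prop := exists b mant e, is_repr r b mant e.

Definition flt_even (r : R) : Prop :=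
  exists b mant e, is_repr r b mant e /\ Z.even mant = true.

Definition Omega : R := (powerRZ 2 emax * (2 - powerRZ 2 (- Z.of_nat M)))%R.
Definition eps : R := powerRZ 2 (- Z.of_nat M - 1).

Definition is_rnd (x f : R) : Prop :=
  in_F f /\ (forall g, in_F g -> (Rabs (x - f) <= Rabs (x - g))%R) /\
  (forall g, in_F g -> g <> f -> Rabs (x - g) = Rabs (x - f) -> flt_even f).
End Format.

Inductive xfloat := Fin (r : R) | PInf | MInf | NaN.

Definition in_Fbar E M (y : xfloat) : Prop :=
  match y with Fin r => in_F E M r | _ => True end.

Definition rnd E M (x : R) : xfloat :=
  if Rle_dec (Omega E M + powerRZ 2 (emax E) * eps M) (Rabs x) then
    (if Rlt_dec 0 x then PInf else MInf)
  else Fin (epsilon (inhabits 0%R) (fun f => is_rnd E M x f)).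

Definition fadd E M (a b : xfloat) : xfloat :=
  match a, b with
  | Fin x, Fin y => rnd E M (x + y)
  | NaN, _ | _, NaN => NaN
  | PInf, MInf | MInf, PInf => NaN
  | PInf, _ | _, PInf => PInf
  | MInf, _ | _, MInf => MInf
  end.

Definition sgn_inf (pos : bool) : xfloat := if pos then PInf else MInf.

Definition fmul E M (a b : xfloat) : xfloat :=
  match a, b with
  | Fin x, Fin y => rnd E M (x * y)
  | NaN, _ | _, NaN => NaN
  | PInf, PInf | MInf, MInf => PInf
  | PInf, MInf | MInf, PInf => MInf
  | PInf, Fin y | Fin y, PInf =>
      if Req_EM_T y 0 then NaN else sgn_inf (if Rlt_dec 0 y then true else false)
  | MInf, Fin y | Fin y, MInf =>
      if Req_EM_T y 0 then NaN else sgn_inf (if Rlt_dec 0 y then false else true)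
  end.

Definition xle (a b : xfloat) : Prop :=
  match a, b with
  | MInf, (MInf | Fin _ | PInf) => True
  | Fin x, Fin y => (x <= y)%R
  | Fin _, PInf => True
  | PInf, PInf => True
  | _, _ => False
  end.

Definition xmin (a b : xfloat) : xfloat :=
  match a, b with
  | MInf, _ | _, MInf => MInf
  | PInf, y => y
  | x, PInf => x
  | Fin x, Fin y => Fin (Rmin x y)
  | _, _ => NaN
  end.

Definition xmax (a b : xfloat) : xfloat :=
  match a, b with
  | PInf, _ | _, PInf => PInf
  | MInf, y => y
  | x, MInf => x
  | Fin x, Fin y => Fin (Rmax x y)
  | _, _ => NaN
  end.

Definition is_nan (a : xfloat) : bool := if a is NaN then true else false.

Inductive itv := Itv (a b : xfloat) | Top.

Definition valid_itv E M (I : itv) : Prop :=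
  match I with
  | Itv a b => in_Fbar E M a /\ in_Fbar E M b /\ a <> NaN /\ b <> NaN /\ xle a b
  | Top => True
  end.

Definition in_gamma E M (I : itv) (y : xfloat) : Prop :=
  match I with
  | Itv a b => in_Fbar E M y /\ xle a y /\ xle y b
  | Top => in_Fbar E M y
  end.

Definition itv_op (f : xfloat -> xfloat -> xfloat) (I J : itv) : itv :=
  match I, J with
  | Itv a b, Itv c d =>
      let s1 := f a c in let s2 := f a d in let s3 := f b c in let s4 := f b d in
      if is_nan s1 || is_nan s2 || is_nan s3 || is_nan s4 then Top
      else Itv (xmin (xmin s1 s2) (xmin s3 s4)) (xmax (xmax s1 s2) (xmax s3 s4))
  | _, _ => Top
  end.

Inductive fop := OAdd | OMul.

Inductive term (n : nat) := Inp (i : 'I_n) | Var (k : nat) | Cst (c : R).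

Record slp (n m : nat) := SLP {
  assigns : list (fop * term n * term n);   (* v_0 := .., v_1 := .., ... *)
  outs : 'I_m -> term n
}.

(* term t may appear in the k-th assignment (only v_0..v_{k-1} defined) *)
Definition wf_term E M n (k : nat) (t : term n) : Prop :=
  match t with
  | Inp _ => True
  | Var v => (v < k)%coq_nat
  | Cst c => in_F E M c
  end.

Fixpoint wf_assigns E M n (k : nat) (l : list (fop * term n * term n)) : Prop :=
  match l with
  | nil => True
  | (_, u, u') :: l' => wf_term E M k u /\ wf_term E M k u' /\ wf_assigns E M (S k) l'
  end.

Definition wf_slp E M n m (Q : slp n m) : Prop :=
  wf_assigns E M 0 (assigns Q) /\
  forall j, wf_term E M (length (assigns Q)) (outs Q j).

Definition eval_term D n (inp : 'I_n -> D) (cst : R -> D) (d0 : D)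
    (env : list D) (t : term n) : D :=
  match t with
  | Inp i => inp i
  | Var k => nth k env d0
  | Cst c => cst c
  end.

Fixpoint run D n (opD : fop -> D -> D -> D) (inp : 'I_n -> D) (cst : R -> D)
    (d0 : D) (l : list (fop * term n * term n)) (env : list D) : list D :=
  match l with
  | nil => env
  | (o, u, u') :: l' =>
      run opD inp cst d0 l'
        (env ++ (opD o (eval_term inp cst d0 env u) (eval_term inp cst d0 env u') :: nil))
  end.

Definition sem D n m (opD : fop -> D -> D -> D) (cst : R -> D) (d0 : D)
    (Q : slp n m) (inp : 'I_n -> D) (j : 'I_m) : D :=
  eval_term inp cst d0 (run opD inp cst d0 (assigns Q) nil) (outs Q j).

Definition fop_sem E M (o : fop) : xfloat -> xfloat -> xfloat :=
  match o with OAdd => fadd E M | OMul => fmul E M end.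

Definition conc_sem E M n m (Q : slp n m) (x : 'I_n -> R) : 'I_m -> xfloat :=
  sem (fop_sem E M) Fin NaN Q (fun i => Fin (x i)).

Definition itv_sem E M n m (Q : slp n m) (B : 'I_n -> itv) : 'I_m -> itv :=
  sem (fun o => itv_op (fop_sem E M o)) (fun c => Itv (Fin c) (Fin c)) Top Q B.

(* Main.v *)
(** Multiplying by a positive constant and adding a constant are monotone after rounding, so interval
    evaluation of a chain of such operations is exact. Iterating [x |-> rnd (x * 5/8)] sends every positive
    float to the least positive float [eta] (below which it cannot round) and every negative one to
    [- eta]; doubling then gives the exact sign of [x]. Hence [sgn (sgn (x - c) + 1)] is an interval-exact
    threshold function. Conjunctions (products) of thresholds are interval-exact indicators of boxes,
    and disjunctions (signs of sums) over all boxes contained in a set [S] are interval-exact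
    indicators of [S], because a box lies in, or meets, [S] iff it lies in, or meets, one of these boxes.
    Finally [P] is the telescoping sum over consecutive floats [u < v] of [(v - u) * 1{P >= v}]: all
    increments are floats and all partial sums are exact. *)

Require Import Defs.
From Stdlib Require Import Reals ZArith Lra Lia List ClassicalEpsilon FunctionalExtensionality.
From mathcomp Require Import ssreflect ssrbool ssrfun eqtype ssrnat seq fintype finfun.
Set Implicit Arguments.
Unset Strict Implicit.
Unset Printing Implicit Defensive.

(** * Rounding *)

Section Floats.
Local Open Scope Z_scope.
Variables E M : nat.
Hypothesis hE : (5 <= E)%coq_nat.
Hypothesis hM3 : (3 <= M)%coq_nat.
Hypothesis hM : Z.of_nat M <= 2 ^ (Z.of_nat E - 1).

Notation m := (Z.of_nat M).

(** * Floats as integer multiples of the least positive float *)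

Definition exp_range : Z := emax E - emin E.
(** The least positive float; every float is an integer multiple of it. *)
Definition eta : R := powerRZ 2 (emin E - m).
Notation D := exp_range.

Lemma format_bounds : 15 <= emax E /\ emin E = 1 - emax E /\ 3 <= m <= emax E + 1.
Proof.
rewrite /emax /emin.
have := Z.pow_le_mono_r 2 4 (Z.of_nat E - 1) ltac:(lia) ltac:(lia).
lia.
Qed.

Lemma exp_range_bounds : 29 <= D /\ m + 13 <= D.
Proof. have := format_bounds; rewrite /D; lia. Qed.

(** Signed significand [j] and shifted exponent [i] of a float measured in units of [eta]. In these
    units subnormal and normal floats are treated alike, by integer arithmetic. *)
Definition repr_int (n j i : Z) : Prop := n = j * 2 ^ i /\ Z.abs j < 2 ^ (m + 1) /\ 0 <= i <= D.
Definition flt_int (n : Z) : Prop := exists j i, repr_int n j i.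
Definition even_int (n : Z) : Prop := exists j i, repr_int n j i /\ Z.even j = true.
Definition Omega_int : Z := (2 ^ (m + 1) - 1) * 2 ^ D.

Lemma pow2_IZR (i : Z) : 0 <= i -> powerRZ 2 i = IZR (2 ^ i).
Proof.
move=> hi; rewrite -(Z2Nat.id i hi) -(pow_IZR 2) pow_powerRZ //.
Qed.

Lemma eta_gt0 : (0 < eta)%R.
Proof. by apply: powerRZ_lt; lra. Qed.

Lemma eta_le (a b : R) : (a * eta <= b * eta <-> a <= b)%R.
Proof. have := eta_gt0; split; [nra | move=> ?; nra]. Qed.

Lemma eta_lt (a b : R) : (a * eta < b * eta <-> a < b)%R.
Proof. have := eta_gt0; split; [nra | move=> ?; nra]. Qed.

Lemma repr_intP (n j i : Z) : repr_int n j i ->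
  is_repr E M (IZR n * eta) (j <? 0) (Z.abs j) (emin E + i).
Proof.
move=> [-> [hj hi]]; split; first by lia.
split; first by move: hi; rewrite /D; lia.
have -> : emin E + i - m = i + (emin E - m) by lia.
rewrite powerRZ_add; last by lra.
rewrite pow2_IZR; last by lia.
rewrite /eta mult_IZR.
have -> : IZR j = ((if j <? 0 then -1 else 1) * IZR (Z.abs j))%R.
  case: Z.ltb_spec => h; last by rewrite Z.abs_eq //; lra.
  by rewrite Z.abs_neq ?opp_IZR; [lra | lia].
ring.
Qed.

Lemma is_repr_int (r : R) b j e : is_repr E M r b j e ->
  exists n, r = (IZR n * eta)%R /\ repr_int n (if b then - j else j) (e - emin E).
Proof.
move=> [hj [he ->]]; exists ((if b then - j else j) * 2 ^ (e - emin E)); split; last first.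
  split => //; split; first by case: b; lia.
  rewrite /D; lia.
have -> : e - m = (e - emin E) + (emin E - m) by lia.
rewrite powerRZ_add; last by lra.
rewrite pow2_IZR; last by lia.
rewrite mult_IZR /eta; case: b; rewrite ?opp_IZR; ring.
Qed.

Lemma in_FP (r : R) : in_F E M r <-> exists n, flt_int n /\ r = (IZR n * eta)%R.
Proof.
split.
  by move=> [b [j [e /is_repr_int [n [-> h]]]]]; exists n; split=> //; eexists; eexists; exact: h.
by move=> [n [[j [i /repr_intP h]] ->]]; eexists; eexists; eexists; exact: h.
Qed.

Lemma flt_int_inF (n : Z) : flt_int n -> in_F E M (IZR n * eta).
Proof. by move=> h; apply/in_FP; exists n. Qed.

Lemma even_int_flt (n : Z) : even_int n -> flt_even E M (IZR n * eta).
Proof.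
move=> [j [i [/repr_intP h ev]]]; eexists; eexists; eexists; split; first exact: h.
by case: (Z.abs_eq_or_opp j) => ->; rewrite ?Z.even_opp.
Qed.

Lemma flt_int_opp (n : Z) : flt_int n -> flt_int (- n).
Proof.
by move=> [j [i [-> [h1 h2]]]]; exists (- j), i; split; [lia | split => //; lia].
Qed.

Lemma even_int_opp (n : Z) : even_int n -> even_int (- n).
Proof.
move=> [j [i [[-> [h1 h2]] ev]]]; exists (- j), i; rewrite Z.even_opp.
by split => //; split; [lia | split => //; lia].
Qed.

Lemma flt_int_mul (j i : Z) : Z.abs j < 2 ^ (m + 1) -> 0 <= i <= D -> flt_int (j * 2 ^ i).
Proof. by exists j, i. Qed.

Lemma flt_int_pow (k : Z) : 0 <= k <= D + m -> flt_int (2 ^ k).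
Proof.
have hD := exp_range_bounds; move=> hk.
case: (Z_le_gt_dec k D) => h.
  have -> : 2 ^ k = 1 * 2 ^ k by lia.
  apply: flt_int_mul; last by lia.
  by have := Z.pow_le_mono_r 2 1 (m + 1) ltac:(lia) ltac:(lia); lia.
have -> : 2 ^ k = 2 ^ (k - D) * 2 ^ D by rewrite -Z.pow_add_r; [congr Z.pow|..]; lia.
apply: flt_int_mul; last by lia.
rewrite Z.abs_eq; last by lia.
by apply: Z.pow_lt_mono_r; lia.
Qed.

Lemma flt_int_small (j : Z) : Z.abs j < 2 ^ (m + 1) -> flt_int j.
Proof.
have hD := exp_range_bounds; move=> h; rewrite -(Z.mul_1_r j).
by apply: (flt_int_mul (i := 0)) => //; lia.
Qed.

Lemma flt_int_bound (n : Z) : flt_int n -> Z.abs n <= Omega_int.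
Proof.
move=> [j [i [-> [hj hi]]]]; rewrite Z.abs_mul (Z.abs_eq (2 ^ i)); last by lia.
by apply: Z.mul_le_mono_nonneg; [lia | lia | lia | apply: Z.pow_le_mono_r; lia].
Qed.

Lemma Omega_int_flt : flt_int Omega_int.
Proof.
have hD := exp_range_bounds; apply: flt_int_mul; last lia.
have := Z.pow_le_mono_r 2 1 (m + 1) ltac:(lia) ltac:(lia); lia.
Qed.

Lemma OmegaE : Omega E M = (IZR Omega_int * eta)%R.
Proof.
have hD := exp_range_bounds.
rewrite /Omega /Omega_int /eta mult_IZR minus_IZR -!pow2_IZR; [|lia..].
have -> : powerRZ 2 (emin E - m) = (powerRZ 2 (emax E) * powerRZ 2 (- m) * powerRZ 2 (- D))%R.
  by rewrite -!powerRZ_add; try lra; congr powerRZ; rewrite /D; lia.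
have h1 : (powerRZ 2 D * powerRZ 2 (- D) = 1)%R.
  by rewrite -powerRZ_add; try lra; rewrite Z.add_opp_diag_r.
have h2 : (powerRZ 2 (m + 1) * powerRZ 2 (- m) = 2)%R.
  rewrite -powerRZ_add; try lra.
  by have -> : m + 1 + - m = 1 by [lia]; rewrite /= ; lra.
transitivity (powerRZ 2 (emax E) * (powerRZ 2 (m + 1) * powerRZ 2 (- m) - powerRZ 2 (- m))
  * (powerRZ 2 D * powerRZ 2 (- D)))%R; last by ring.
by rewrite h1 h2; ring.
Qed.

(** * Neighbouring floats and parity of significands *)

Lemma repr_canonical (n : Z) : flt_int n -> 0 <= n ->
  exists j i, repr_int n j i /\ 0 <= j /\ (i = 0 \/ 2 ^ m <= j).
Proof.
move=> [j [i [-> [hj hi]]]]; have [k ek] : exists k, i = Z.of_nat k by exists (Z.to_nat i); lia.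
(* As long as the top bit of [j] is clear, a factor 2 moves from the exponent to the significand. *)
subst i; elim: k j hj hi => [|k IH] j hj hi hn.
  exists j, 0; split; [by split => //; lia | split; [lia | by left]].
case: (Z_le_gt_dec (2 ^ m) j) => h.
  by exists j, (Z.of_nat k.+1); split => //; split; [lia | by right].
have e : j * 2 ^ Z.of_nat k.+1 = (j * 2) * 2 ^ Z.of_nat k.
  by rewrite Nat2Z.inj_succ Z.pow_succ_r; lia.
have hj0 : 0 <= j by have := Z.pow_pos_nonneg 2 (Z.of_nat k.+1) ltac:(lia) ltac:(lia); nia.
rewrite e in hn *; apply: IH => //; last lia.
have -> : m + 1 = Z.succ m by lia.
by rewrite Z.pow_succ_r; lia.
Qed.

(** The successor is one unit in the last place away, a power of two and hence itself a float.
    Consecutive significands have opposite parity, and a carry out of the top bit yields the even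
    significand [2 ^ m]. *)
Lemma succ_nonneg (n g : Z) : flt_int n -> 0 <= n -> flt_int g -> n < g ->
  exists u, flt_int (n + u) /\ 0 < u /\ flt_int u /\ n + u <= g /\ (even_int n \/ even_int (n + u)).
Proof.
have hD := exp_range_bounds.
move=> hn n0 hg ng.
have [j [i [[en [hj hi]] [j0 hc]]]] := repr_canonical hn n0.
exists (2 ^ i).
have pi : 0 < 2 ^ i by apply: Z.pow_pos_nonneg; lia.
have enu : n + 2 ^ i = (j + 1) * 2 ^ i by rewrite en; lia.
have em : 2 ^ (m + 1) = 2 * 2 ^ m by rewrite -Z.pow_succ_r; [congr Z.pow|]; lia.
have nug : n + 2 ^ i <= g.
  have := hg => -[j' [i' [eg [hj' hi']]]].
  (* If the exponent of [g] is at least [i], then [g] is a multiple of [2 ^ i]; if it is smaller,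
     [g] is below [2 ^ m * 2 ^ i], which is at most [n]. *)
  case: (Z_le_gt_dec i i') => h.
    have e2 : 2 ^ i' = 2 ^ (i' - i) * 2 ^ i by rewrite -Z.pow_add_r; [congr Z.pow|..]; lia.
    rewrite eg e2 in ng *; rewrite en in ng *.
    suff : j < j' * 2 ^ (i' - i) by nia.
    nia.
  case: hc => [?|hc]; first lia.
  have e2 : 2 ^ i = 2 * 2 ^ (i - 1) by rewrite -Z.pow_succ_r; [congr Z.pow|]; lia.
  have le2 : 2 ^ i' <= 2 ^ (i - 1) by apply: Z.pow_le_mono_r; lia.
  have : 0 < 2 ^ i' by apply: Z.pow_pos_nonneg; lia.
  have : 0 < 2 ^ m by apply: Z.pow_pos_nonneg; lia.
  nia.
have u_flt : flt_int (2 ^ i) by rewrite -(Z.mul_1_l (2 ^ i)); apply: flt_int_mul; lia.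
have jb : Z.abs j = j by lia.
case: (Z_lt_le_dec (j + 1) (2 ^ (m + 1))) => h.
  have r1 : repr_int (n + 2 ^ i) (j + 1) i by split; [lia | lia].
  split; first by exists (j + 1), i.
  do 3 (split; first by []).
  case ev: (Z.even j); first by left; exists j, i.
  by right; exists (j + 1), i; rewrite Z.even_add ev.
(* The carry case: the significand is renormalised to [2 ^ m] with exponent [i + 1]. This exponent
   is in range because the float [g] above [n] shows that [n] is not the largest float. *)
have ej : j + 1 = 2 * 2 ^ m by lia.
have iD : i < D.
  case: (Z_lt_le_dec i D) => // h'; have := flt_int_bound hg; rewrite /Omega_int.
  have <- : i = D by lia.
  have : j * 2 ^ i < g by lia. nia.
have m1 : 2 ^ m = 2 * 2 ^ (m - 1) by rewrite -Z.pow_succ_r; [congr Z.pow|]; lia.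
have r1 : repr_int (n + 2 ^ i) (2 ^ m) (i + 1).
  split; last lia. by rewrite enu ej Z.pow_add_r; lia.
split; first by exists (2 ^ m), (i + 1).
do 3 (split; first by []).
by right; exists (2 ^ m), (i + 1); split=> //; rewrite m1 Z.even_mul.
Qed.

(** The gap later serves as an increment of the telescoping sum; the even neighbour settles ties in
    rounding. *)
Lemma adjacent_int (f g : Z) : flt_int f -> flt_int g -> f < g ->
  (forall h, flt_int h -> ~ (f < h < g)) ->
  flt_int (g - f) /\ (even_int f \/ even_int g).
Proof.
move=> hf hg fg adj.
case: (Z_le_gt_dec 0 f) => h0.
  have [u [h1 [h2 [h3 [h4 h5]]]]] := succ_nonneg hf h0 hg fg.
  have e : g = f + u by have := adj _ h1; lia.
  by rewrite e; split=> //; have -> : f + u - f = u by lia.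
(* Zero is a float, so adjacent floats do not straddle it; with [f] negative, negation reduces to
   [succ_nonneg]. *)
have g0 : 0 <= - g.
  suff : ~ (f < 0 < g) by lia.
  by apply: adj; apply: flt_int_small; rewrite /=; apply: Z.pow_pos_nonneg; lia.
have [u [h1 [h2 [h3 [h4 h5]]]]] := succ_nonneg (flt_int_opp hg) g0 (flt_int_opp hf) ltac:(lia).
have e : - f = - g + u.
  by have := adj _ (flt_int_opp h1); lia.
split; first by have -> : g - f = u by lia.
rewrite -e in h5; case: h5 => /even_int_opp; rewrite Z.opp_involutive; tauto.
Qed.

Local Open Scope R_scope.

(** * Finite enumeration of floats, existence and monotonicity of rounding *)

Lemma finite_min (T : Type) (le : T -> T -> Prop) (f : nat -> T) (K : nat) (S : T -> Prop) :
  (forall x y, le x y \/ le y x) -> (forall x y z, le x y -> le y z -> le x z) ->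
  (forall x, S x -> exists k, (k < K)%coq_nat /\ x = f k) -> (exists x, S x) ->
  exists x, S x /\ forall y, S y -> le x y.
Proof.
move=> tot tr; elim: K S => [|K IH] S cov [x0 Sx0].
  by have [k [hk _]] := cov _ Sx0; lia.
have refl x : le x x by case: (tot x x).
case: (classic (exists x, S x /\ x <> f K)) => [[x1 [Sx1 nx1]]|hn].
  have [x [[Sx nx] hx]] := IH (fun x => S x /\ x <> f K)
    ltac:(move=> y [Sy ny]; have [k [hk ey]] := cov _ Sy; exists k; split=> //;
          case: (Nat.eq_dec k K) => ek; [by subst | lia]) ltac:(by exists x1).
  case: (classic (S (f K))) => SK; last first.
    by exists x; split=> // y Sy; apply: hx; split=> // ey; subst.
  case: (tot x (f K)) => h.
    exists x; split=> // y Sy; case: (classic (y = f K)) => [-> //|ny]; exact: hx.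
  exists (f K); split=> // y Sy; case: (classic (y = f K)) => [-> //|ny].
  by apply: (tr _ x) => //; apply: hx.
have e x : S x -> x = f K by move=> Sx; apply: NNPP => nx; apply: hn; exists x.
by exists x0; split=> // y /e ->; rewrite (e _ Sx0).
Qed.

(** The first [flt_count] values are all multiples of [eta] from [- Omega] to [Omega], floats or
    not; only surjectivity onto the floats matters. *)
Definition flt_enum (k : nat) : R := IZR (Z.of_nat k - Omega_int) * eta.
Definition flt_count : nat := Z.to_nat (2 * Omega_int + 1).

Lemma flt_enum_onto (r : R) : in_F E M r -> exists k, (k < flt_count)%coq_nat /\ r = flt_enum k.
Proof.
move=> /in_FP [n [/flt_int_bound hn ->]].
exists (Z.to_nat (n + Omega_int)); split; first by rewrite /flt_count; lia.
by rewrite /flt_enum Z2Nat.id; [congr (IZR _ * _); lia | lia].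
Qed.

Lemma is_repr_opp (r : R) b j e : is_repr E M r b j e -> is_repr E M (- r) (~~ b) j e.
Proof. by move=> [h1 [h2 ->]]; split=> //; split=> //; case: b => /=; ring. Qed.

Lemma in_F_opp (r : R) : in_F E M r -> in_F E M (- r).
Proof. by move=> [b [j [e /is_repr_opp h]]]; exists (~~ b), j, e. Qed.

Lemma flt_even_opp (r : R) : flt_even E M r -> flt_even E M (- r).
Proof. by move=> [b [j [e [/is_repr_opp h ev]]]]; exists (~~ b), j, e. Qed.

Lemma is_rnd_opp (x f : R) : is_rnd E M x f -> is_rnd E M (- x) (- f).
Proof.
have opp a b : Rabs (- a - b) = Rabs (a - - b) by rewrite -Rabs_Ropp; congr Rabs; ring.
move=> [h1 [h2 h3]]; split; first exact: in_F_opp.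
split=> [g hg|g hg gf]; rewrite !opp Ropp_involutive.
  by apply: h2; exact: in_F_opp.
move=> e; apply: flt_even_opp; apply: (h3 (- g)) => //; first exact: in_F_opp.
lra.
Qed.

Lemma in_F_bound (r : R) : in_F E M r -> - Omega E M <= r <= Omega E M.
Proof.
move=> /in_FP [n [/flt_int_bound hn ->]]; rewrite OmegaE.
rewrite Ropp_mult_distr_l -opp_IZR.
by split; apply/eta_le; apply: IZR_le; lia.
Qed.

Lemma Omega_inF : in_F E M (Omega E M).
Proof. rewrite OmegaE; exact: flt_int_inF Omega_int_flt. Qed.

Lemma in_F0 : in_F E M 0.
Proof.
have -> : 0 = IZR 0 * eta by lra.
by apply: flt_int_inF; apply: flt_int_small; apply: Z.pow_pos_nonneg; lia.
Qed.

Lemma adjacent_flt (f g : R) : in_F E M f -> in_F E M g -> f < g ->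
  (forall h, in_F E M h -> ~ (f < h < g)) ->
  in_F E M (g - f) /\ (flt_even E M f \/ flt_even E M g).
Proof.
move=> /in_FP [a [ha ->]] /in_FP [b [hb ->]] /eta_lt/lt_IZR ab adj.
have [h1 h2] : flt_int (b - a) /\ (even_int a \/ even_int b).
  apply: adjacent_int => // h hh hab; apply: (adj _ (flt_int_inF hh)).
  by split; apply/eta_lt; apply: IZR_lt; lia.
split; first by rewrite -Rmult_minus_distr_r -minus_IZR; exact: flt_int_inF.
by case: h2 => /even_int_flt; tauto.
Qed.

(** [rnd] chooses its finite values with [epsilon], so a value must be shown to exist. If two
    distinct floats are nearest, no float lies between them, since it would be nearer; hence one of
    the two is even. *)
Lemma is_rnd_exists (x : R) : exists f, is_rnd E M x f.
Proof.
have [f [hf near]] : exists f, in_F E M f /\ forall g, in_F E M g -> Rabs (x - f) <= Rabs (x - g).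
  apply: (@finite_min _ (fun f g => Rabs (x - f) <= Rabs (x - g)) flt_enum flt_count).
  - by move=> a b; lra.
  - by move=> a b c; lra.
  - exact: flt_enum_onto.
  - by exists 0; exact: in_F0.
case: (classic (exists g, in_F E M g /\ g <> f /\ Rabs (x - g) = Rabs (x - f))); last first.
  by move=> hn; exists f; split=> //; split=> // g hg gf e; case: hn; exists g.
move=> [g [hg [gf e]]].
have ev : flt_even E M f \/ flt_even E M g.
  have adj a b : in_F E M a -> in_F E M b -> a < b -> Rabs (x - a) = Rabs (x - f) ->
      Rabs (x - b) = Rabs (x - f) -> flt_even E M a \/ flt_even E M b.
    move=> ha hb ab ea eb; apply: (adjacent_flt ha hb ab _).2 => h hh [h1 h2].
    have := near h hh; move: ea eb; split_Rabs; lra.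
  case: (Rtotal_order f g) => [h|[h|h]]; [|by subst|].
    exact: adj.
  by case: (adj g f hg hf h e erefl); tauto.
case: ev => ev; [exists f | exists g]; split=> //; split=> // h hh; rewrite ?e => *; exact: near.
Qed.

Definition overflow : R := Omega E M + powerRZ 2 (emax E) * eps M.

Lemma Omega_gt0 : 0 < Omega E M.
Proof.
have hD := exp_range_bounds.
rewrite OmegaE; apply: Rmult_lt_0_compat eta_gt0; apply: IZR_lt.
have h1 := Z.pow_le_mono_r 2 1 (m + 1) ltac:(lia) ltac:(lia).
have h2 := Z.pow_pos_nonneg 2 D ltac:(lia) ltac:(lia).
rewrite /Omega_int; nia.
Qed.

Lemma overflow_gt : Omega E M < overflow.
Proof.
have := powerRZ_lt 2 (emax E) ltac:(lra); have := powerRZ_lt 2 (- m - 1) ltac:(lra).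
rewrite /overflow /eps; nra.
Qed.

Lemma rnd_cases (x : R) :
  (overflow <= x /\ rnd E M x = PInf) \/ (x <= - overflow /\ rnd E M x = MInf) \/
  (- overflow < x < overflow /\ exists f, rnd E M x = Fin f /\ is_rnd E M x f).
Proof.
have o1 := Omega_gt0; have o2 := overflow_gt.
rewrite /rnd; case: Rle_dec => /= h.
  rewrite -/overflow in h; case: Rlt_dec => h0; [left | right; left]; split=> //;
  move: h; split_Rabs; lra.
right; right; rewrite -/overflow in h; split; first by move: h; split_Rabs; lra.
eexists; split; first by [].
apply: epsilon_spec; exact: is_rnd_exists.
Qed.

(** If [g < f], nearness would put [x] at or above the midpoint of [g] and [f], and [y] at or below
    it. *)
Lemma is_rnd_mono (x y f g : R) : is_rnd E M x f -> is_rnd E M y g -> x < y -> f <= g.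
Proof.
move=> [hf [nf _]] [hg [ng _]] xy; apply: Rnot_lt_le => gf.
have := nf g hg; have := ng f hf; split_Rabs; lra.
Qed.

Lemma rnd_mono (x y : R) : x <= y -> xle (rnd E M x) (rnd E M y).
Proof.
have o1 := Omega_gt0; have o2 := overflow_gt.
move=> [xy|<-]; last by case: (rnd_cases x) => [[_ ->]|[[_ ->]|[_ [f [-> _]]]]] //=; lra.
case: (rnd_cases x) => [[hx ->]|[[hx ->]|[hx [f [-> hf]]]]];
case: (rnd_cases y) => [[hy ->]|[[hy ->]|[hy [g [-> hg]]]]] //=; try lra.
exact: is_rnd_mono hf hg xy.
Qed.

Lemma rnd_id (x : R) : in_F E M x -> rnd E M x = Fin x.
Proof.
move=> hx; have hb := in_F_bound hx; have o2 := overflow_gt.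
case: (rnd_cases x) => [[h _]|[[h _]|[_ [f [-> [_ [h _]]]]]]]; try lra.
suff -> : f = x by [].
by have := h x hx; split_Rabs; lra.
Qed.

Lemma rnd_between (l u x : R) : in_F E M l -> in_F E M u -> l <= x <= u ->
  exists f, rnd E M x = Fin f /\ is_rnd E M x f /\ l <= f <= u.
Proof.
move=> hl hu [lx xu]; have := rnd_mono lx; have := rnd_mono xu; rewrite (rnd_id hl) (rnd_id hu).
case: (rnd_cases x) => [[_ ->]|[[_ ->]|[_ [f [-> h]]]]] //= ? ?.
by exists f.
Qed.

(** * Contraction towards the least positive float *)

Lemma eta_inF : in_F E M eta.
Proof.
have hD := exp_range_bounds.
by rewrite -(Rmult_1_l eta); apply: flt_int_inF; apply: (flt_int_pow (k := 0)); lia.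
Qed.

(** As [5 / 8 > 1 / 2], this keeps the contraction from rounding a positive float to zero. *)
Lemma is_rnd_ge_eta (y f : R) : is_rnd E M y f -> eta / 2 < y -> eta <= f.
Proof.
have e0 := eta_gt0.
move=> [/in_FP [n [_ ->]] [near _]] hy.
case: (Z_lt_le_dec 0 n) => hn.
  by rewrite -{1}(Rmult_1_l eta); apply/eta_le; apply: IZR_le; lia.
have : IZR n * eta <= 0 * eta by apply/eta_le; apply: IZR_le.
have := near eta eta_inF; split_Rabs; lra.
Qed.

Lemma is_rnd_le (x f u : R) : is_rnd E M x f -> in_F E M u -> x <= u -> f <= u.
Proof.
move=> [_ [near _]] hu xu; apply: Rnot_lt_le => uf.
by have := near u hu; split_Rabs; lra.
Qed.

(* A float [x >= 2 eta] has a power of two in [(x/4, x)], which is closer to [5x/8] than [x] is. *)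
Lemma contract_pos (x f : R) : in_F E M x -> eta <= x -> is_rnd E M (x * (5 / 8)) f ->
  eta <= f /\ (f < x \/ f = x /\ x = eta).
Proof.
have e0 := eta_gt0; have hD := exp_range_bounds.
move=> hx ex hr; split; first by apply: is_rnd_ge_eta hr _; lra.
have fx : f <= x by apply: is_rnd_le hr hx _; lra.
have [hf [near _]] := hr.
have [n [hn en]] := (in_FP x).1 hx.
case: (Req_dec f x) => [efx|]; last by left; lra.
right; split=> //.
have n1 : (1 <= n)%Z.
  suff : 0 < IZR n by move/lt_IZR; lia.
  by apply/eta_lt; lra.
case: (Z_lt_le_dec 1 n) => n2; last first.
  by have -> : x = IZR 1 * eta; [rewrite en; congr (IZR _ * _); lia | lra].
(* The logarithm of [n - 1] makes [2 ^ k] strictly smaller than [n] even when [n] is a power of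
   two. *)
have [l1 l2] := Z.log2_spec (n - 1) ltac:(lia).
set k := Z.log2 (n - 1) in l1 l2.
have k0 : (0 <= k)%Z by apply: Z.log2_nonneg.
have ek : (2 ^ Z.succ k = 2 * 2 ^ k)%Z by rewrite Z.pow_succ_r.
have kD : (k <= D + m)%Z.
  have hO := flt_int_bound hn.
  have e1 : (2 ^ (D + m + 1) = 2 ^ (m + 1) * 2 ^ D)%Z.
    by rewrite -Z.pow_add_r; [congr Z.pow|..]; lia.
  have : (2 ^ k < 2 ^ (D + m + 1))%Z.
    have := Z.pow_pos_nonneg 2 D ltac:(lia) ltac:(lia).
    by move: hO; rewrite e1 /Omega_int; lia.
  by move/(proj2 (Z.pow_lt_mono_r_iff 2 k (D + m + 1) ltac:(lia) ltac:(lia))); lia.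
have := near _ (flt_int_inF (flt_int_pow (conj k0 kD))).
have lt1 : IZR (2 ^ k) * eta < x by rewrite en; apply/eta_lt; apply: IZR_lt; lia.
have lt2 : x < 4 * IZR (2 ^ k) * eta.
  by rewrite en -mult_IZR; apply/eta_lt; apply: IZR_lt; lia.
by rewrite efx; split_Rabs; lra.
Qed.

Lemma eta_le_inF (x : R) : in_F E M x -> 0 < x -> eta <= x.
Proof.
move=> /in_FP [n [_ ->]] h; rewrite -{1}(Rmult_1_l eta); apply/eta_le; apply: IZR_le.
suff : 0 < IZR n by move/lt_IZR; lia.
by apply/eta_lt; lra.
Qed.

(** The sign [s] lets positive and negative floats share one statement: the magnitude strictly drops
    until it is [eta], where it stays. *)
Lemma contract (s x : R) : s = 1 \/ s = -1 -> in_F E M x -> 0 < s * x ->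
  exists f, rnd E M (x * (5 / 8)) = Fin f /\ in_F E M f /\ 0 < s * f /\
    (s * f < s * x \/ f = x /\ s * x = eta).
Proof.
have e0 := eta_gt0; move=> hs hx sx.
have hO := in_F_bound hx.
have hsx : in_F E M (s * x).
  by case: hs => ->; [rewrite Rmult_1_l | have -> : -1 * x = - x by [ring]; apply: in_F_opp].
have [f [ef [rf _]]] : exists f, rnd E M (x * (5 / 8)) = Fin f /\ is_rnd E M (x * (5 / 8)) f /\
    - Omega E M <= f <= Omega E M.
  by apply: rnd_between; [apply: in_F_opp| |]; try exact: Omega_inF; lra.
have rsf : is_rnd E M (s * x * (5 / 8)) (s * f).
  case: hs => ->; first by rewrite !Rmult_1_l.
  have -> : -1 * x * (5 / 8) = - (x * (5 / 8)) by ring.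
  by have -> : -1 * f = - f by [ring]; apply: is_rnd_opp.
have [h1 h2] := contract_pos hsx (eta_le_inF hsx sx) rsf.
exists f; split=> //; split; first by case: rf.
split; first lra.
by case: h2 => [|[h3 h4]]; [left | right; split=> //; case: hs h3 => ->; lra].
Qed.

(** * Exact interval evaluation of monotone operations *)

Lemma xle_refl (x : xfloat) : x <> NaN -> xle x x.
Proof. by case: x => //= r _; lra. Qed.

Lemma xle_trans (x y z : xfloat) : xle x y -> xle y z -> xle x z.
Proof. by case: x => [a| | |]; case: y => [b| | |]; case: z => [c| | |] //=; lra. Qed.

Lemma xmin_l (x y : xfloat) : xle x y -> xmin x y = x.
Proof.
by case: x => [a| | |]; case: y => [b| | |] //= h; rewrite Rmin_left.
Qed.

Lemma xmax_r (x y : xfloat) : xle x y -> xmax x y = y.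
Proof.
by case: x => [a| | |]; case: y => [b| | |] //= h; rewrite Rmax_right.
Qed.

Lemma xmin_r (x y : xfloat) : xle y x -> xmin x y = y.
Proof.
by case: x => [a| | |]; case: y => [b| | |] //= h; rewrite Rmin_right.
Qed.

Lemma xmax_l (x y : xfloat) : xle y x -> xmax x y = x.
Proof.
by case: x => [a| | |]; case: y => [b| | |] //= h; rewrite Rmax_left.
Qed.

Lemma xle_nan (x y : xfloat) : xle x y -> is_nan x = false /\ is_nan y = false.
Proof. by case: x => [a| | |]; case: y => [b| | |]. Qed.

Lemma xle_neq_nan (x y : xfloat) : xle x y -> x <> NaN /\ y <> NaN.
Proof. by case: x => [a| | |]; case: y => [b| | |]. Qed.

Lemma itv_op_mono (f : xfloat -> xfloat -> xfloat) (a b c d : xfloat) :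
  xle (f a c) (f a d) -> xle (f a c) (f b c) -> xle (f a d) (f b d) -> xle (f b c) (f b d) ->
  itv_op f (Itv a b) (Itv c d) = Itv (f a c) (f b d).
Proof.
move=> h1 h2 h3 h4 /=.
rewrite (xle_nan h1).1 (xle_nan h1).2 (xle_nan h4).1 (xle_nan h4).2 /=.
rewrite (xmin_l h1) (xmin_l h4) (xmin_l h2) (xmax_r h1) (xmax_r h4) (xmax_r h3) //.
Qed.

Lemma itv_op_anti (f : xfloat -> xfloat -> xfloat) (a b c : xfloat) :
  xle (f b c) (f a c) -> itv_op f (Itv a b) (Itv c c) = Itv (f b c) (f a c).
Proof.
move=> h /=; rewrite (xle_nan h).1 (xle_nan h).2 /=.
have [n2 n1] := xle_neq_nan h.
have [pp qq] := (xle_refl n1, xle_refl n2).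
by rewrite (xmin_l pp) (xmin_l qq) (xmin_r h) (xmax_r pp) (xmax_r qq) (xmax_l h).
Qed.

Lemma fadd_mono (a b : xfloat) (c d : R) : xle a b -> c <= d ->
  xle (fadd E M a (Fin c)) (fadd E M b (Fin d)).
Proof.
move=> ab cd.
case: a ab => [a| | |]; case: b => [b| | |] //= ab.
- by apply: rnd_mono; lra.
- by case: (rnd_cases (a + c)) => [[_ ->]|[[_ ->]|[_ [f [-> _]]]]].
- by case: (rnd_cases (b + d)) => [[_ ->]|[[_ ->]|[_ [f [-> _]]]]].
Qed.

Lemma itv_add_fin (a b : xfloat) (c d : R) : xle a b -> c <= d ->
  itv_op (fadd E M) (Itv a b) (Itv (Fin c) (Fin d)) = Itv (fadd E M a (Fin c)) (fadd E M b (Fin d)).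
Proof.
move=> ab cd; have [na nb] := xle_neq_nan ab.
by apply: itv_op_mono; apply: fadd_mono => //; try lra; apply: xle_refl.
Qed.

Lemma itv_mul_fin (a b c d : R) : 0 <= a <= b -> 0 <= c <= d ->
  itv_op (fmul E M) (Itv (Fin a) (Fin b)) (Itv (Fin c) (Fin d)) =
  Itv (rnd E M (a * c)) (rnd E M (b * d)).
Proof. by move=> *; apply: itv_op_mono; apply: rnd_mono; nra. Qed.

Lemma fmul_const_mono (a b : xfloat) (k : R) : 0 < k -> xle a b ->
  xle (fmul E M a (Fin k)) (fmul E M b (Fin k)).
Proof.
move=> k0; case: a => [a| | |]; case: b => [b| | |] //= ab;
  do ?(case: Req_EM_T => ? /=; first by lra); do ?(case: Rlt_dec => ? /=; last by lra) => //.
- by apply: rnd_mono; nra.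
- by case: (rnd_cases (a * k)) => [[_ ->]|[[_ ->]|[_ [f [-> _]]]]].
- by case: (rnd_cases (b * k)) => [[_ ->]|[[_ ->]|[_ [f [-> _]]]]].
Qed.

(** * Chains of operations with constants, and the exact sign function *)

Definition chain_step (x : xfloat) (ok : fop * R) : xfloat := fop_sem E M ok.1 x (Fin ok.2).

Definition chain := foldl chain_step.

(** Conditions making a step monotone, so that interval evaluation of it is exact. *)
Definition pos_step (ok : fop * R) : Prop :=
  in_F E M ok.2 /\ (if ok.1 is OMul then 0 < ok.2 else True).

Lemma chain_step_mono (ok : fop * R) (a b : xfloat) : pos_step ok -> xle a b ->
  xle (chain_step a ok) (chain_step b ok).
Proof.
case: ok => [[] k] [/= _ hk] ab; first by apply: fadd_mono => //; lra.
exact: fmul_const_mono.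
Qed.

Lemma chain_cat (c c' : seq (fop * R)) (x : xfloat) : chain x (c ++ c') = chain (chain x c) c'.
Proof. exact: foldl_cat. Qed.

(** Each contraction lowers a magnitude above [eta] by at least one unit [eta], so [Omega_int] of
    them suffice for every float; [m - emin] doublings then take [eta = 2 ^ (emin - m)] to 1. *)
Definition sign_chain : seq (fop * R) :=
  nseq (Z.to_nat Omega_int) (OMul, 5 / 8) ++ nseq (Z.to_nat (m - emin E)) (OMul, 2).

Lemma chain0 (c : seq (fop * R)) : List.Forall (fun ok => ok.1 = OMul) c -> chain (Fin 0) c = Fin 0.
Proof.
elim=> //= -[o k] {}c /= -> _ IH.
by rewrite /chain_step /= Rmult_0_l (rnd_id in_F0).
Qed.

Lemma Forall_nseq (T : Type) (P : T -> Prop) (n : nat) (x : T) : P x -> List.Forall P (nseq n x).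
Proof. by move=> h; elim: n => //= n IH; constructor. Qed.

Lemma chain_contract (N : nat) (s x : R) : s = 1 \/ s = -1 -> in_F E M x -> 0 < s * x ->
  s * x <= INR N.+1 * eta -> chain (Fin x) (nseq N (OMul, 5 / 8)) = Fin (s * eta).
Proof.
have e0 := eta_gt0.
have fin y : s = 1 \/ s = -1 -> s * y = eta -> y = s * eta by case=> ->; lra.
move=> hs; elim: N x => [|N IH] x hx sx.
  move=> /= h; congr Fin; apply: fin => //.
  have := @eta_le_inF (s * x); case: hs sx h => -> sx h; rewrite ?Rmult_1_l in sx h *.
    by move/(_ hx sx); lra.
  have -> : -1 * x = - x by ring.
  by move/(_ (in_F_opp hx)); lra.
rewrite [INR _]S_INR => h; have [f [ef [hf [sf h1]]]] := contract hs hx sx.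
have -> : chain (Fin x) (nseq N.+1 (OMul, 5 / 8)) = chain (Fin f) (nseq N (OMul, 5 / 8)).
  by rewrite /chain /= /chain_step /= ef.
apply: IH => //.
case: h1 => [lt|[-> e]]; last first.
  by rewrite e -{1}(Rmult_1_l eta); apply/eta_le; rewrite S_INR; have := pos_INR N; lra.
(* Both magnitudes are integer multiples of [eta], so a strict decrease is a decrease by at least
   [eta]. *)
have hd : exists k, s * f = IZR k * eta /\ exists l, s * x = IZR l * eta.
  move: hf hx => /in_FP [k [_ ->]] /in_FP [l [_ ->]].
  by case: hs => ->; [exists k | exists (- k)%Z]; (split; first by rewrite ?opp_IZR; ring);
     [exists l | exists (- l)%Z]; rewrite ?opp_IZR; ring.
move: hd => [k [ek [l el]]]; rewrite ek el in lt h *.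
move: lt h => /eta_lt/lt_IZR lt /eta_le h; apply/eta_le.
have : IZR (k + 1) <= IZR l by apply: IZR_le; lia.
rewrite plus_IZR; lra.
Qed.

Lemma chain_double (N : nat) (s : R) (i : Z) : s = 1 \/ s = -1 -> (0 <= i)%Z ->
  (i + Z.of_nat N <= D + m)%Z ->
  chain (Fin (s * (IZR (2 ^ i) * eta))) (nseq N (OMul, 2)) =
  Fin (s * (IZR (2 ^ (i + Z.of_nat N)) * eta)).
Proof.
move=> hs; elim: N i => [|N IH] i i0 hi.
  by rewrite /= Z.add_0_r.
have -> : (i + Z.of_nat N.+1 = (i + 1) + Z.of_nat N)%Z by lia.
have e : rnd E M (s * (IZR (2 ^ i) * eta) * 2) = Fin (s * (IZR (2 ^ (i + 1)) * eta)).
  have -> : s * (IZR (2 ^ i) * eta) * 2 = s * (IZR (2 ^ (i + 1)) * eta).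
    by rewrite Z.pow_add_r; [rewrite mult_IZR Z.pow_1_r; ring | lia | lia].
  apply: rnd_id.
  have h : in_F E M (IZR (2 ^ (i + 1)) * eta) by apply: flt_int_inF; apply: flt_int_pow; lia.
  case: hs => ->; first by rewrite Rmult_1_l.
  have -> (x : R) : -1 * x = - x by ring.
  exact: in_F_opp.
rewrite -IH; try lia.
by rewrite {1}/chain /= {2}/chain_step /= e.
Qed.

Lemma one_eta : IZR (2 ^ (m - emin E)) * eta = 1.
Proof.
have hf := format_bounds.
rewrite -pow2_IZR; last lia.
by rewrite /eta -powerRZ_add; [have -> : (m - emin E + (emin E - m) = 0)%Z by [lia] | lra].
Qed.

Lemma sign_chain_sgn (s x : R) : s = 1 \/ s = -1 -> in_F E M x -> 0 < s * x ->
  chain (Fin x) sign_chain = Fin s.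
Proof.
have hf := format_bounds; have hD : D = (emax E - emin E)%Z by [].
move=> hs hx sx; rewrite chain_cat.
have hb := in_F_bound hx.
rewrite (chain_contract hs hx sx); last first.
  have : s * x <= Omega E M by case: hs => ->; lra.
  rewrite OmegaE => h; apply: Rle_trans h _; apply/eta_le.
  rewrite INR_IZR_INZ; apply: IZR_le; lia.
have -> : eta = IZR (2 ^ 0) * eta by rewrite /= ; lra.
rewrite chain_double //; try lia.
rewrite Z2Nat.id; last lia.
by rewrite one_eta Rmult_1_r.
Qed.

Lemma sign_chain0 : chain (Fin 0) sign_chain = Fin 0.
Proof. by apply: chain0; apply/List.Forall_app; split; apply: Forall_nseq. Qed.

Lemma pow_inF (k : Z) : (0 <= k + (m - emin E) <= D + m)%Z -> in_F E M (powerRZ 2 k).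
Proof.
move=> hk; have -> : powerRZ 2 k = IZR (2 ^ (k + (m - emin E))) * eta.
  by rewrite -pow2_IZR ?/eta -?powerRZ_add; try lra; try lia; congr powerRZ; lia.
by apply: flt_int_inF; apply: flt_int_pow.
Qed.

Lemma const_inF : in_F E M 1 /\ in_F E M 2 /\ in_F E M (/ 2) /\ in_F E M (5 / 8).
Proof.
have hf := format_bounds; have hD : D = (emax E - emin E)%Z by [].
split; first by apply: (pow_inF (k := 0)); lia.
split; first by have -> : 2 = powerRZ 2 1 by [rewrite /=; lra]; apply: pow_inF; lia.
split; first by have -> : / 2 = powerRZ 2 (-1) by [rewrite /=; lra]; apply: pow_inF; lia.
have -> : 5 / 8 = IZR (5 * 2 ^ (m - emin E - 3)) * eta.
  have := one_eta.
  have -> : (m - emin E = m - emin E - 3 + 3)%Z by lia.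
  rewrite Z.pow_add_r; try lia.
  by rewrite !mult_IZR /= => h; have -> : (m - emin E - 3 + 3 - 3 = m - emin E - 3)%Z by [lia]; lra.
apply: flt_int_inF; apply: flt_int_mul; last lia.
by have := Z.pow_le_mono_r 2 3 (m + 1) ltac:(lia) ltac:(lia); lia.
Qed.

Lemma sign_chain_pos : List.Forall pos_step sign_chain.
Proof.
have [_ [h2 [_ h58]]] := const_inF.
by apply/List.Forall_app; split; apply: Forall_nseq; split=> //=; lra.
Qed.

(** * Threshold functions *)

Definition step_chain (c : R) : seq (fop * R) :=
  (OAdd, - c) :: sign_chain ++ (OAdd, 1) :: sign_chain.

Lemma step_chain_pos (c : R) : in_F E M c -> List.Forall pos_step (step_chain c).
Proof.
move=> hc; constructor; first by split => //=; apply: in_F_opp.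
apply/List.Forall_app; split; first exact: sign_chain_pos.
constructor; [by split=> //=; case: const_inF | exact: sign_chain_pos].
Qed.

(* [sgn (sgn (x - c) + 1)] is [1] for [x >= c] and [0] otherwise. *)
Lemma step_chain_sem (c x : R) : in_F E M c -> in_F E M x -> Rabs (x - c) < overflow ->
  chain (Fin x) (step_chain c) = Fin (if Rle_dec c x then 1 else 0).
Proof.
have [h1 [h2 _]] := const_inF; have e0 := eta_gt0.
move=> hc hx hov.
have -> : chain (Fin x) (step_chain c) =
    chain (chain_step (chain (rnd E M (x - c)) sign_chain) (OAdd, 1)) sign_chain.
  by rewrite /step_chain /= {1}/chain /= foldl_cat.
have [f [-> rf]] : exists f, rnd E M (x - c) = Fin f /\ is_rnd E M (x - c) f.
  by case: (rnd_cases (x - c)) => [[h _]|[[h _]|[_ //]]]; move: hov; split_Rabs; lra.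
(* Gradual underflow: the exact difference is a multiple of [eta], so a nonzero difference does not
   round to zero. *)
have [k ek] : exists k, x - c = IZR k * eta.
  move: hx hc => /in_FP [a [_ ->]] /in_FP [b [_ ->]].
  by exists (a - b)%Z; rewrite minus_IZR; ring.
have hf : in_F E M f by case: rf.
have gap : 0 < IZR k -> eta <= IZR k * eta.
  move/lt_IZR => k0; rewrite -{1}(Rmult_1_l eta); apply/eta_le; apply: IZR_le; lia.
case: Rle_dec => h.
  have f0 : 0 <= f.
    have := is_rnd_le (is_rnd_opp rf) in_F0 ltac:(lra); lra.
  have [t [-> t01]] : exists t, chain (Fin f) sign_chain = Fin t /\ (t = 0 \/ t = 1).
    case: f0 => [f0|<-]; last by exists 0; rewrite sign_chain0; tauto.
    by exists 1; rewrite (@sign_chain_sgn 1) //; [tauto | tauto | lra].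
  have h2' : in_F E M (t + 1) by case: t01 => ->; rewrite ?Rplus_0_l.
  rewrite /chain_step /= (rnd_id h2'); apply: sign_chain_sgn => //; first tauto.
  by case: t01 => ->; lra.
have k0 : IZR (- k) * eta > 0 by rewrite opp_IZR; lra.
have f0 : f < 0.
  suff : eta <= - f by lra.
  apply: (is_rnd_ge_eta (is_rnd_opp rf)).
  have : 1 * eta <= IZR (- k) * eta.
    apply/eta_le; apply: IZR_le.
    suff : 0 < IZR (- k) by move/lt_IZR; lia.
    by apply/eta_lt; lra.
  by rewrite opp_IZR; lra.
rewrite (@sign_chain_sgn (-1)) //; [|tauto|lra].
have e : -1 + 1 = 0 by lra.
by rewrite /chain_step /= e (rnd_id in_F0) sign_chain0.
Qed.

(** A magnitude of [2 ^ (m + 1)] units does not fit into a significand with shifted exponent 0, so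
    the exponent can be lowered by one. *)
Lemma in_F_half (x : R) : in_F E M x -> IZR (2 ^ (m + 1)) * eta <= Rabs x -> in_F E M (x / 2).
Proof.
move=> /in_FP [n [hn ->]]; have [j [i [en [hj hi]]]] := hn.
rewrite Rabs_mult (Rabs_pos_eq eta); last by have := eta_gt0; lra.
rewrite -abs_IZR => /eta_le/le_IZR hn2.
have i0 : (0 < i)%Z.
  case: (Z_lt_le_dec 0 i) => // h; have ei : i = 0%Z by lia.
  by move: en; rewrite ei; lia.
have -> : IZR n * eta / 2 = IZR (j * 2 ^ (i - 1)) * eta.
  have -> : n = (j * 2 ^ (i - 1) * 2)%Z.
    by rewrite en -Z.mul_assoc (Z.mul_comm _ 2) -Z.pow_succ_r; [congr (_ * 2 ^ _)%Z|]; lia.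
  by rewrite (mult_IZR _ 2); lra.
by apply: flt_int_inF; apply: flt_int_mul; lia.
Qed.

(** Small enough that [x - c] cannot overflow when [c] is within it, and twice the magnitude from
    which halving is known to be exact. *)
Definition threshold : R := IZR (2 ^ (m + 2)) * eta.

Lemma overflow_sub : overflow - Omega E M = IZR (2 ^ (D - 1)) * eta.
Proof.
have hf := format_bounds.
rewrite /overflow /eps -pow2_IZR; last by rewrite /D; lia.
rewrite /eta -!powerRZ_add; try lra.
have -> : (D - 1 + (emin E - m) = emax E + (- m - 1))%Z by rewrite /D; lia.
lra.
Qed.

Lemma threshold_small : threshold < overflow - Omega E M.
Proof.
have hD := exp_range_bounds; rewrite overflow_sub.
by apply/eta_lt; apply: IZR_lt; apply: Z.pow_lt_mono_r; lia.
Qed.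

Definition cut_chain (c : R) : seq (fop * R) :=
  if Rle_dec (Rabs c) threshold then step_chain c else (OMul, / 2) :: step_chain (c / 2).

Lemma threshold_half : threshold = 2 * (IZR (2 ^ (m + 1)) * eta).
Proof.
rewrite /threshold; have -> : (m + 2 = Z.succ (m + 1))%Z by lia.
by rewrite Z.pow_succ_r; [rewrite mult_IZR; ring | lia].
Qed.

Lemma cut_chain_pos (c : R) : in_F E M c -> List.Forall pos_step (cut_chain c).
Proof.
have e0 := eta_gt0; have [_ [_ [h2 _]]] := const_inF.
rewrite /cut_chain => hc; case: Rle_dec => h; first exact: step_chain_pos.
constructor; first by split=> //=; lra.
apply: step_chain_pos; apply: in_F_half => //.
have := Rabs_pos c; rewrite threshold_half in h; lra.
Qed.

(* Halving [x] and [c] keeps [x - c] from overflowing; when [|c|] exceeds the threshold it is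
   exact near [c], so the order with respect to [c] is preserved. *)
Lemma cut_chain_sem (c x : R) : in_F E M c -> in_F E M x ->
  chain (Fin x) (cut_chain c) = Fin (if Rle_dec c x then 1 else 0).
Proof.
have e0 := eta_gt0; have o1 := Omega_gt0; have o2 := overflow_gt; have o3 := threshold_small.
move=> hc hx; have bx := in_F_bound hx; have bc := in_F_bound hc.
rewrite /cut_chain; case: Rle_dec => h.
  by apply: step_chain_sem => //; move: h; split_Rabs; lra.
set T := IZR (2 ^ (m + 1)) * eta.
have eT : threshold = 2 * T by rewrite threshold_half.
have T0 : 0 < T.
  apply: Rmult_lt_0_compat e0; apply: IZR_lt; apply: Z.pow_pos_nonneg; lia.
have hD := exp_range_bounds.
have hO : T <= Omega E M.
  rewrite OmegaE; apply/eta_le; apply: IZR_le; rewrite /Omega_int.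
  have p1 := Z.pow_le_mono_r 2 1 (m + 1) ltac:(lia) ltac:(lia).
  have p2 := Z.pow_le_mono_r 2 1 D ltac:(lia) ltac:(lia).
  nia.
have hc2 : in_F E M (c / 2) by apply: in_F_half => //; rewrite -/T; lra.
have hO2 : in_F E M (Omega E M / 2).
  by apply: in_F_half; [exact: Omega_inF | rewrite -/T Rabs_pos_eq; lra].
have hO2' : in_F E M (- (Omega E M / 2)) by exact: in_F_opp.
(* With both halves bounded by [Omega / 2], their difference stays within [Omega]. *)
have [f [ef [rf bf]]] := rnd_between (x := x / 2) hO2' hO2 ltac:(lra).
have -> : chain (Fin x) ((OMul, / 2) :: step_chain (c / 2)) = chain (Fin f) (step_chain (c / 2)).
  by rewrite -ef.
rewrite step_chain_sem //; first last.
- by move: bc bf; split_Rabs; lra.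
- by case: rf.
case: (Rle_dec c x) => cx; case: Rle_dec => cf //.
  exfalso; apply: cf.
  have := is_rnd_le (is_rnd_opp rf) (in_F_opp hc2) ltac:(lra); lra.
exfalso; apply: cx.
apply: Rnot_lt_le => xc.
(* If [Rabs x] is at least [T], halving [x] is exact. Otherwise [f] is at most [T / 2], while
   [x < c] leaves only [c > 2 * T]. *)
case: (Rle_dec T (Rabs x)) => hT.
  have : f <= x / 2 by apply: is_rnd_le rf (in_F_half hx hT) _; lra.
  lra.
have T2 : in_F E M (T / 2).
  have -> : T / 2 = IZR (2 ^ m) * eta.
    rewrite /T; have -> : (m + 1 = Z.succ m)%Z by lia.
    by rewrite Z.pow_succ_r; [rewrite mult_IZR; lra | lia].
  by apply: flt_int_inF; apply: flt_int_pow; lia.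
have : f <= T / 2 by apply: is_rnd_le rf T2 _; move: hT; split_Rabs; lra.
move: hT h; split_Rabs; lra.
Qed.

(** * Expressions and their compilation to straight-line programs *)

Section Expressions.
Variable n : nat.

(** Trees can be nested freely; variable addresses appear only at compilation. *)
Inductive expr := EInp (i : 'I_n) | ECst (c : R) | EOp (o : fop) (e e' : expr).

Fixpoint wf_expr (e : expr) : Prop :=
  match e with
  | EInp _ => True
  | ECst c => in_F E M c
  | EOp _ e e' => wf_expr e /\ wf_expr e'
  end.

Fixpoint itv_eval (B : 'I_n -> itv) (e : expr) : itv :=
  match e with
  | EInp i => B i
  | ECst c => Itv (Fin c) (Fin c)
  | EOp o e e' => itv_op (fop_sem E M o) (itv_eval B e) (itv_eval B e')
  end.

Definition instr := (fop * term n * term n)%type.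

(** [k] counts the variables already assigned, so it is the first fresh address. *)
Fixpoint compile (k : nat) (e : expr) : list instr * term n :=
  match e with
  | EInp i => ([::], Inp i)
  | ECst c => ([::], Cst n c)
  | EOp o e e' =>
      let p := compile k e in
      let p' := compile (k + size p.1)%N e' in
      (p.1 ++ p'.1 ++ [:: (o, p.2, p'.2)], Var n (k + size p.1 + size p'.1)%N)
  end.

Notation run_itv B := (run (fun o => itv_op (fop_sem E M o)) B (fun c => Itv (Fin c) (Fin c)) Top).
Notation eval_itv B := (eval_term B (fun c => Itv (Fin c) (Fin c)) Top).

Lemma run_cat (D : Type) (op : fop -> D -> D -> D) (inp : 'I_n -> D) cst d0
    (l l' : list instr) (env : list D) :
  run op inp cst d0 (l ++ l') env = run op inp cst d0 l' (run op inp cst d0 l env).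
Proof. by elim: l env => //= -[[o u] u'] l IH env; rewrite IH. Qed.

Lemma wf_term_le (k k' : nat) (t : term n) : (k <= k')%N -> wf_term E M k t -> wf_term E M k' t.
Proof. by case: t => //= v kk /ltP h; apply/ltP; apply: leq_trans h kk. Qed.

Lemma wf_assigns_cat (k : nat) (l l' : list instr) :
  wf_assigns E M k l -> wf_assigns E M (k + size l)%N l' -> wf_assigns E M k (l ++ l').
Proof.
elim: l k => [|[[o u] u'] l IH] k /=; first by rewrite addn0.
by rewrite addnS -addSn => -[h1 [h2 h3]] h4; split=> //; split=> //; apply: IH.
Qed.

Lemma compile_wf (e : expr) (k : nat) : wf_expr e ->
  wf_assigns E M k (compile k e).1 /\ wf_term E M (k + size (compile k e).1)%N (compile k e).2.
Proof.
elim: e k => //= o e1 IH1 e2 IH2 k [/(IH1 k) [h1 h2] /(IH2 (k + size (compile k e1).1)%N) [h3 h4]].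
rewrite !size_cat /=; split; last by clear; rewrite -!plusE; lia.
apply: wf_assigns_cat => //; apply: wf_assigns_cat => //=; split; last by split.
exact: wf_term_le (leq_addr _ _) h2.
Qed.

Lemma nth_nthE (T : Type) (k : nat) (s : list T) (d : T) : List.nth k s d = nth d s k.
Proof. by elim: s k => [|x s IH] [|k] //=. Qed.

(** The arbitrary suffix [ext'] records that later assignments leave the value of the compiled term
    unchanged. *)
Lemma compile_sem (B : 'I_n -> itv) (e : expr) (env : list itv) :
  exists ext, run_itv B (compile (size env) e).1 env = env ++ ext /\
    size ext = size (compile (size env) e).1 /\
    forall ext', eval_itv B (env ++ ext ++ ext') (compile (size env) e).2 = itv_eval B e.
Proof.
elim: e env => [i|c|o e1 IH1 e2 IH2] env /=; try by exists [::]; rewrite cats0.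
have [x1 [r1 [s1 v1]]] := IH1 env.
have := IH2 (env ++ x1); rewrite size_cat s1 => -[x2 [r2 [s2 v2]]].
set p1 := compile (size env) e1 in r1 s1 v1 s2 v2 r2 *; set p2 := compile _ e2 in r2 s2 v2 *.
have q1 := v1 x2; have := v2 [::]; rewrite cats0 -catA => q2.
exists (x1 ++ x2 ++ [:: itv_op (fop_sem E M o) (itv_eval B e1) (itv_eval B e2)]); split.
  by rewrite !run_cat r1 r2 /= -catA q1 q2 !catA.
split; first by rewrite !size_cat s1 s2.
move=> ext'; rewrite /= nth_nthE.
have -> : (size env + size p1.1 + size p2.1)%N = size (env ++ x1 ++ x2).
  by rewrite !size_cat s1 s2 addnA.
rewrite -!catA catA catA -(catA env) /=.
by rewrite nth_cat ltnn subnn.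
Qed.

(** The expressions are compiled one after another into a single program. Indexing the family by
    [nat] permits induction on their number. *)
Lemma compile_all (es : nat -> expr) (p : nat) : (forall k, wf_expr (es k)) ->
  exists (l : list instr) (ts : nat -> term n), wf_assigns E M 0 l /\
    (forall k, (k < p)%N -> wf_term E M (size l) (ts k)) /\
    forall B, size (run_itv B l [::]) = size l /\
      forall k ext, (k < p)%N -> eval_itv B (run_itv B l [::] ++ ext) (ts k) = itv_eval B (es k).
Proof.
move=> wf; elim: p => [|p [l [ts [w1 [w2 h]]]]].
  by exists [::], (fun=> Var n 0).
have [c1 c2] := compile_wf (size l) (wf p).
exists (l ++ (compile (size l) (es p)).1),
  (fun k => if k == p then (compile (size l) (es p)).2 else ts k).
split; first exact: wf_assigns_cat.
split.
  move=> k; rewrite size_cat; case: eqP => [_ _ //|/eqP nk].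
  rewrite ltnS leq_eqVlt (negbTE nk) /= => /w2; apply: wf_term_le; exact: leq_addr.
move=> B; have [s1 v1] := h B; rewrite run_cat.
have [x [r [s v]]] := compile_sem B (es p) (run_itv B l [::]).
rewrite s1 in r s v; rewrite r !size_cat s1 s; split=> // k ext.
case: eqP => [-> _|/eqP nk]; first by rewrite -catA v.
by rewrite ltnS leq_eqVlt (negbTE nk) /= => hk; rewrite -catA v1.
Qed.

(** * Indicators of boxes and of arbitrary sets *)

Definition ind (A : Prop) : R := if excluded_middle_informative A then 1 else 0.

Lemma ind_true (A : Prop) : A -> ind A = 1.
Proof. by rewrite /ind; case: excluded_middle_informative. Qed.

Lemma ind_false (A : Prop) : ~ A -> ind A = 0.
Proof. by rewrite /ind; case: excluded_middle_informative. Qed.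

Lemma ind_ext (A A' : Prop) : (A <-> A') -> ind A = ind A'.
Proof.
by move=> h; rewrite /ind; do 2 (case: excluded_middle_informative => ? //=); exfalso; tauto.
Qed.

Lemma ind_le (A A' : Prop) : (A -> A') -> 0 <= ind A <= ind A'.
Proof.
move=> h; rewrite /ind.
by do 2 (case: excluded_middle_informative => ? /=); try (exfalso; tauto); lra.
Qed.

(* [A] and [A'] are the values of a truth-valued expression at the two ends of the box. *)
Definition truth_itv (A A' : Prop) : itv := Itv (Fin (ind A)) (Fin (ind A')).

Lemma truth_itv_ext (A1 A1' A2 A2' : Prop) : (A1 <-> A2) -> (A1' <-> A2') ->
  truth_itv A1 A1' = truth_itv A2 A2'.
Proof. by move=> h h'; rewrite /truth_itv (ind_ext h) (ind_ext h'). Qed.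

Definition chain_expr : expr -> seq (fop * R) -> expr :=
  foldl (fun e ok => EOp ok.1 e (ECst ok.2)).

Lemma chain_expr_wf (e : expr) (c : seq (fop * R)) : List.Forall pos_step c -> wf_expr e ->
  wf_expr (chain_expr e c).
Proof. by move=> hc; elim: hc e => //= ok {}c [h _] _ IH e we; apply: IH. Qed.

Lemma chain_expr_sem (B : 'I_n -> itv) (e : expr) (c : seq (fop * R)) (a b : xfloat) :
  List.Forall pos_step c -> xle a b -> itv_eval B e = Itv a b ->
  itv_eval B (chain_expr e c) = Itv (chain a c) (chain b c).
Proof.
move=> hc; elim: hc e a b => //= -[o k] {}c hok _ IH e a b ab eb.
apply: IH; first exact: chain_step_mono.
rewrite [LHS]/= eb; case: o hok => -[/= hk k0]; first exact: itv_add_fin ab (Rle_refl k).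
have [na nb] := xle_neq_nan ab.
by apply: itv_op_mono; apply: fmul_const_mono => //; apply: xle_refl.
Qed.

Lemma cut_chain_ind (c x : R) : in_F E M c -> in_F E M x ->
  chain (Fin x) (cut_chain c) = Fin (ind (c <= x)).
Proof.
move=> hc hx; rewrite cut_chain_sem //; congr Fin.
by case: Rle_dec => h; [rewrite ind_true | rewrite ind_false].
Qed.

Definition float_box (a b : 'I_n -> R) : Prop :=
  forall i, in_F E M (a i) /\ in_F E M (b i) /\ a i <= b i.

Definition in_box (a b x : 'I_n -> R) : Prop := forall i, in_F E M (x i) /\ a i <= x i <= b i.

Definition box_itv (a b : 'I_n -> R) (i : 'I_n) : itv := Itv (Fin (a i)) (Fin (b i)).

Definition ge_expr (c : R) (i : 'I_n) : expr := chain_expr (EInp i) (cut_chain c).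
(** [x <= c] is tested as [- c <= - x]; negation is exact and merely swaps the ends of an
    interval. *)
Definition le_expr (c : R) (i : 'I_n) : expr :=
  chain_expr (EOp OMul (EInp i) (ECst (-1))) (cut_chain (- c)).

Lemma opp1_inF : in_F E M (-1).
Proof. by apply: (@in_F_opp 1); case: const_inF. Qed.

Lemma ge_expr_sem (c : R) (i : 'I_n) (a b : 'I_n -> R) : in_F E M c -> float_box a b ->
  itv_eval (box_itv a b) (ge_expr c i) = truth_itv (c <= a i) (c <= b i).
Proof.
move=> hc /(_ i) [ha [hb ab]].
by rewrite (chain_expr_sem (cut_chain_pos hc) (a := Fin (a i)) (b := Fin (b i))) // !cut_chain_ind.
Qed.

Lemma le_expr_sem (c : R) (i : 'I_n) (a b : 'I_n -> R) : in_F E M c -> float_box a b ->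
  itv_eval (box_itv a b) (le_expr c i) = truth_itv (b i <= c) (a i <= c).
Proof.
move=> hc /(_ i) [ha [hb ab]].
have na := in_F_opp ha; have nb := in_F_opp hb; have nc := in_F_opp hc.
have e (r : R) : in_F E M (- r) -> fmul E M (Fin r) (Fin (-1)) = Fin (- r).
  by move=> h; rewrite -(rnd_id h) /=; congr rnd; ring.
rewrite (chain_expr_sem (cut_chain_pos nc) (a := Fin (- b i)) (b := Fin (- a i))) /=; last first.
- have h : xle (fmul E M (Fin (b i)) (Fin (-1))) (fmul E M (Fin (a i)) (Fin (-1))).
    by rewrite !e //=; lra.
  by have := itv_op_anti h; rewrite !e.
- lra.
by rewrite !cut_chain_ind //; apply: truth_itv_ext; lra.
Qed.

Lemma ind_inF (A : Prop) : in_F E M (ind A).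
Proof.
by rewrite /ind; case: excluded_middle_informative => ? /=; [case: const_inF | exact: in_F0].
Qed.

Lemma and_expr_sem (B : 'I_n -> itv) (e e' : expr) (A A' C C' : Prop) : (A -> A') -> (C -> C') ->
  itv_eval B e = truth_itv A A' -> itv_eval B e' = truth_itv C C' ->
  itv_eval B (EOp OMul e e') = truth_itv (A /\ C) (A' /\ C').
Proof.
move=> hA hC /= -> ->; rewrite [LHS]itv_mul_fin; try exact: ind_le.
have h (X Y : Prop) : rnd E M (ind X * ind Y) = Fin (ind (X /\ Y)).
  have -> : ind X * ind Y = ind (X /\ Y).
    by rewrite /ind; do 3 (case: excluded_middle_informative => ? /=); try (exfalso; tauto); lra.
  exact: (rnd_id (ind_inF _)).
by rewrite !h.
Qed.

(** The sign sends the possible sums 0, 1, 2 of truth values to 0, 1, 1. *)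
Definition or_expr (e e' : expr) : expr := chain_expr (EOp OAdd e e') sign_chain.

Lemma or_expr_sem (B : 'I_n -> itv) (e e' : expr) (A A' C C' : Prop) : (A -> A') -> (C -> C') ->
  itv_eval B e = truth_itv A A' -> itv_eval B e' = truth_itv C C' ->
  itv_eval B (or_expr e e') = truth_itv (A \/ C) (A' \/ C').
Proof.
move=> hA hC eA eC.
have iA := ind_le hA; have iC := ind_le hC; have [h1 [h2 _]] := const_inF.
have add (X Y : Prop) : in_F E M (ind X + ind Y).
  rewrite /ind; do 2 (case: excluded_middle_informative => ? /=); rewrite ?Rplus_0_l ?Rplus_0_r //.
  exact: in_F0.
rewrite (chain_expr_sem sign_chain_pos (a := Fin (ind A + ind C)) (b := Fin (ind A' + ind C'))).
- have h (X Y : Prop) : chain (Fin (ind X + ind Y)) sign_chain = Fin (ind (X \/ Y)).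
    case: (classic (X \/ Y)) => XY.
      rewrite (ind_true XY); apply: sign_chain_sgn => //; first by left.
      rewrite /ind; do 2 (case: excluded_middle_informative => ? /=); try (exfalso; tauto); lra.
    rewrite (ind_false XY) !ind_false ?Rplus_0_l; try tauto; exact: sign_chain0.
  by rewrite !h.
- rewrite /=; lra.
- by rewrite /= eA eC [LHS]itv_add_fin /=; [rewrite !rnd_id | lra | lra].
Qed.

Definition box_expr (c d : 'I_n -> R) : expr :=
  foldr (fun i e => EOp OMul (EOp OMul (ge_expr (c i) i) (le_expr (d i) i)) e) (ECst 1) (enum 'I_n).

Lemma box_expr_wf (c d : 'I_n -> R) : float_box c d -> wf_expr (box_expr c d).
Proof.
move=> hcd; rewrite /box_expr; elim: (enum _) => [|i r IH] /=; first by case: const_inF.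
have [h1 [h2 _]] := hcd i; split=> //; split; apply: chain_expr_wf => //=.
- exact: cut_chain_pos.
- by apply: cut_chain_pos; apply: in_F_opp.
- by split=> //; exact: opp1_inF.
Qed.

(** The lower end expresses that [[a, b]] lies in [[c, d]], the upper end that the two boxes meet.
    Testing the comparisons separately loses nothing: two intervals meet as soon as each starts no
    later than the other ends, and coordinates are independent. *)
Lemma box_expr_sem (c d a b : 'I_n -> R) : float_box c d -> float_box a b ->
  itv_eval (box_itv a b) (box_expr c d) =
  truth_itv (forall i, c i <= a i /\ b i <= d i) (forall i, c i <= b i /\ a i <= d i).
Proof.
move=> hcd hab.
have -> : itv_eval (box_itv a b) (box_expr c d) =
    truth_itv (forall i, i \in enum 'I_n -> c i <= a i /\ b i <= d i)
              (forall i, i \in enum 'I_n -> c i <= b i /\ a i <= d i).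
  rewrite /box_expr; elim: (enum _) => [|i r IH] /=.
    by rewrite /truth_itv !ind_true.
  have [hc [hd _]] := hcd i; have [_ [_ ab]] := hab i.
  rewrite -[itv_op _ _ _]/(itv_eval (box_itv a b)
    (EOp OMul (EOp OMul (ge_expr (c i) i) (le_expr (d i) i)) _)).
  rewrite (and_expr_sem _ _ (and_expr_sem _ _ (ge_expr_sem i hc hab) (le_expr_sem i hd hab)) IH);
    try by move=> *; lra.
  - by apply: truth_itv_ext; split=> [[h1 h2] k|h]; try (split=> [|k kr]; apply: h;
      rewrite inE ?eqxx ?kr ?orbT //); rewrite inE => /orP [/eqP -> //|]; apply: h2.
  - by move=> h k kr; have := h k kr; have [_ [_]] := hab k; lra.
by apply: truth_itv_ext; split=> h i; [apply: h; rewrite mem_enum | move=> _; apply: h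
  | apply: h; rewrite mem_enum | move=> _; apply: h].
Qed.

Lemma any_expr_sem (T : eqType) (s : seq T) (h : T -> expr) (A A' : T -> ('I_n -> itv) -> Prop)
    (B : 'I_n -> itv) :
  (forall t, t \in s -> A t B -> A' t B) ->
  (forall t, t \in s -> itv_eval B (h t) = truth_itv (A t B) (A' t B)) ->
  itv_eval B (foldr (fun t e => or_expr (h t) e) (ECst 0) s) =
  truth_itv (exists2 t, t \in s & A t B) (exists2 t, t \in s & A' t B).
Proof.
elim: s => [|t s IH] hA hs.
  by rewrite /= /truth_itv !ind_false //; case.
have ts k : k \in s -> k \in t :: s by rewrite inE orbC => ->.
have tt : t \in t :: s by rewrite inE eqxx.
have ex (C : T -> ('I_n -> itv) -> Prop) :
    C t B \/ (exists2 k, k \in s & C k B) <-> exists2 k, k \in t :: s & C k B.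
  split=> [[Ct|[k ks Ck]]|[k]]; [by exists t | by exists k => //; apply: ts |].
  by rewrite inE => /orP [/eqP ->|ks] Ck; [left | right; exists k].
rewrite [foldr _ _ _]/=.
rewrite (or_expr_sem _ _ (hs t tt) (IH _ _)); first exact: truth_itv_ext.
- exact: hA.
- by move=> [k ks Ak]; exists k => //; apply: hA => //; apply: ts.
- by move=> k /ts; apply: hA.
- by move=> k /ts; apply: hs.
Qed.

Lemma in_box_sub (c d a b x : 'I_n -> R) : (forall i, c i <= a i /\ b i <= d i) ->
  in_box a b x -> in_box c d x.
Proof. by move=> h hx i; have [h1 h2] := h i; have [h3 h4] := hx i; split=> //; lra. Qed.

Lemma boxes_meet (c d a b : 'I_n -> R) : float_box c d -> float_box a b ->
  (forall i, c i <= b i /\ a i <= d i) -> exists x, in_box a b x /\ in_box c d x.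
Proof.
move=> hcd hab h; exists (fun i => Rmax (a i) (c i)).
by split=> i; have [g1 g2] := h i; have [h1 [h2 h3]] := hcd i; have [h4 [h5 h6]] := hab i;
  rewrite /Rmax; case: Rle_dec => ?; split=> //; lra.
Qed.

Lemma in_point_box (x y : 'I_n -> R) : in_box x x y -> y = x.
Proof. by move=> h; apply: functional_extensionality => i; have [_] := h i; lra. Qed.

(** Coding corners by a finite type makes the set of candidate boxes enumerable; those whose corners
    are not floats are filtered out by [good]. *)
Definition grid_point (t : {ffun 'I_n -> 'I_flt_count}) (i : 'I_n) : R := flt_enum (t i).

(* A box lies in [S] iff it lies in some box contained in [S], and it meets [S] iff it meets such a
   box; hence the disjunction of the indicators of all boxes contained in [S] is exact on boxes. *)
Lemma set_expr (S : ('I_n -> R) -> Prop) : exists e, wf_expr e /\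
  forall a b, float_box a b -> itv_eval (box_itv a b) e =
    truth_itv (forall x, in_box a b x -> S x) (exists x, in_box a b x /\ S x).
Proof.
pose T := {ffun 'I_n -> 'I_flt_count}.
pose good (cd : T * T) := float_box (grid_point cd.1) (grid_point cd.2) /\
  forall x, in_box (grid_point cd.1) (grid_point cd.2) x -> S x.
pose s := [seq cd <- enum {: T * T} |
  if excluded_middle_informative (good cd) then true else false].
have mem_s cd : cd \in s <-> good cd.
  by rewrite mem_filter mem_enum inE andbT; case: excluded_middle_informative.
have onto (x : 'I_n -> R) : (forall i, in_F E M (x i)) -> exists t, grid_point t = x.
  move=> hx.
  have [f hf] : exists f : 'I_n -> 'I_flt_count, forall i, x i = flt_enum (f i).
    apply: (@fin_all_exists _ (fun=> 'I_flt_count) (fun i k => x i = flt_enum k)) => i.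
    have [k [/ltP hk ek]] := flt_enum_onto (hx i).
    by exists (Ordinal hk).
  exists (finfun f); apply: functional_extensionality => i.
  by rewrite /grid_point ffunE hf.
exists (foldr (fun cd => or_expr (box_expr (grid_point cd.1) (grid_point cd.2))) (ECst 0) s); split.
  have : forall cd, cd \in s -> good cd by move=> cd /mem_s.
  elim: s {mem_s} => [_|cd s IH hs] /=; first exact: in_F0.
  apply: chain_expr_wf; first exact: sign_chain_pos.
  split; first by apply: box_expr_wf; case: (hs cd); rewrite ?inE ?eqxx.
  by apply: IH => k ks; apply: hs; rewrite inE ks orbT.
move=> a b hab.
rewrite (@any_expr_sem _ s _
  (fun cd _ => forall i, grid_point cd.1 i <= a i /\ b i <= grid_point cd.2 i)
  (fun cd _ => forall i, grid_point cd.1 i <= b i /\ a i <= grid_point cd.2 i)); first last.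
- by move=> cd /mem_s [hcd _]; apply: box_expr_sem.
- move=> [c d] _ h i; have [h1 h2] := h i; have [_ [_ h3]] := hab i.
  by split; [apply: Rle_trans h1 h3 | apply: Rle_trans h3 h2].
apply: truth_itv_ext; split.
- by move=> [cd /mem_s [_ hS] h] x hx; apply: hS; apply: in_box_sub hx.
- move=> h.
  (* A box contained in [S] is itself in the list. *)
  have [c ec] := onto a (fun i => (hab i).1); have [d ed] := onto b (fun i => (hab i).2.1).
  exists (c, d); first by apply/mem_s; split; rewrite /= ec ed.
  by move=> i /=; rewrite ec ed; split; apply: Rle_refl.
- move=> [cd /mem_s [hcd hS] h].
  by have [x [hx hx']] := boxes_meet hcd hab h; exists x; split=> //; apply: hS.
move=> [x [hx Sx]].
(* A point of [S] is a degenerate box contained in [S]. *)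
have [t et] := onto x (fun i => (hx i).1).
exists (t, t); last by move=> i /=; rewrite et; have [_ []] := hx i.
apply/mem_s; split=> /=; rewrite et; last by move=> y /in_point_box ->.
by move=> i; have [h1 h2] := hx i; split=> //; split=> //; apply: Rle_refl.
Qed.

(** * Assembling the output from its level sets *)

Lemma overflow_double : overflow <= Omega E M + Omega E M.
Proof.
have hD := exp_range_bounds; have := overflow_sub.
suff : IZR (2 ^ (D - 1)) * eta <= Omega E M by lra.
rewrite OmegaE; apply/eta_le; apply: IZR_le; rewrite /Omega_int.
have := Z.pow_le_mono_r 2 2 (m + 1) ltac:(lia) ltac:(lia).
have := Z.pow_le_mono_r 2 (D - 1) D ltac:(lia) ltac:(lia).
have := Z.pow_pos_nonneg 2 (D - 1) ltac:(lia) ltac:(lia).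
nia.
Qed.

(** Program constants are finite, so infinite outputs are produced by these two overflows. *)
Lemma rnd_double_Omega : rnd E M (Omega E M + Omega E M) = PInf /\
  rnd E M (- Omega E M + - Omega E M) = MInf.
Proof.
have h := overflow_double; have o1 := Omega_gt0; have o2 := overflow_gt; split.
  by case: (rnd_cases (Omega E M + Omega E M)) => [[_ ->]|[[? _]|[? _]]] //; lra.
by case: (rnd_cases (- Omega E M + - Omega E M)) => [[? _]|[[_ ->]|[? _]]] //; lra.
Qed.

Lemma scaled_expr_sem (B : 'I_n -> itv) (e : expr) (A A' : Prop) (w : R) : (A -> A') ->
  in_F E M w -> 0 <= w -> itv_eval B e = truth_itv A A' ->
  itv_eval B (EOp OMul (ECst w) e) = Itv (Fin (w * ind A)) (Fin (w * ind A')).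
Proof.
move=> hA hw w0 /= ->; rewrite [LHS]itv_mul_fin; [|lra|exact: ind_le].
have h (X : Prop) : in_F E M (w * ind X).
  rewrite /ind; case: excluded_middle_informative => ? /=; rewrite ?Rmult_1_r ?Rmult_0_r //.
  exact: in_F0.
by rewrite !rnd_id.
Qed.

Section Output.
Variable p : ('I_n -> R) -> xfloat.
Hypothesis p_Fbar : forall x, (forall i, in_F E M (x i)) -> in_Fbar E M (p x) /\ p x <> NaN.

Definition range_on (a b : 'I_n -> R) (lo hi : xfloat) : Prop :=
  (exists x, in_box a b x /\ p x = lo) /\ (forall x, in_box a b x -> xle lo (p x)) /\
  (exists x, in_box a b x /\ p x = hi) /\ (forall x, in_box a b x -> xle (p x) hi).

Definition xflt_enum (k : nat) : xfloat :=
  match k with O => PInf | S O => MInf | S (S k) => Fin (flt_enum k) end.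

Lemma xflt_enum_onto (y : xfloat) : in_Fbar E M y -> y <> NaN ->
  exists k, (k < flt_count + 2)%coq_nat /\ y = xflt_enum k.
Proof.
case: y => [r| | |] //=.
- move=> /flt_enum_onto [k [hk ->]] _; exists k.+2; split=> //; rewrite -plusE; lia.
- by exists 0%nat; split=> //; rewrite -plusE; lia.
- by exists 1%nat; split=> //; rewrite -plusE; lia.
Qed.

(** Placing [NaN] on top completes [xle] to a total preorder, as [finite_min] requires. *)
Definition xle_nan_top (x y : xfloat) : Prop := xle x y \/ y = NaN.

Lemma range_exists (a b : 'I_n -> R) : float_box a b -> exists lo hi, range_on a b lo hi.
Proof.
move=> hab.
have cov y : (exists x, in_box a b x /\ p x = y) -> in_Fbar E M y /\ y <> NaN.
  by move=> [x [hx <-]]; apply: p_Fbar => i; case: (hx i).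
pose S y := exists x, in_box a b x /\ p x = y.
have S0 : exists y, S y.
  by exists (p a), a; split=> // i; have [h1 [h2 h3]] := hab i; split=> //; lra.
have fin y : S y -> exists k, (k < flt_count + 2)%coq_nat /\ y = xflt_enum k.
  by move=> /cov [h1 h2]; apply: xflt_enum_onto.
have tot x y : xle_nan_top x y \/ xle_nan_top y x.
  by rewrite /xle_nan_top; case: x => [r| | |]; case: y => [q| | |] /=; try tauto; lra.
have tr x y z : xle_nan_top x y -> xle_nan_top y z -> xle_nan_top x z.
  move=> [h|ey] [h'|ez]; try (by right); first by left; apply: xle_trans h h'.
  by rewrite ey in h'; case: z h'.
have [lo [[x1 [b1 e1]] hlo]] := finite_min tot tr fin S0.
have [hi [[x2 [b2 e2]] hhi]] := @finite_min _ (fun x y => xle_nan_top y x) _ _ _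
  (fun x y => tot y x) (fun x y z h1 h2 => tr z y x h2 h1) fin S0.
exists lo, hi; split; first by exists x1.
split.
  move=> x hx; have Sx : S (p x) by exists x.
  by case: (hlo _ Sx) => // e; case: (cov _ Sx).
split; first by exists x2.
move=> x hx; have Sx : S (p x) by exists x.
have nhi : hi <> NaN by have [] := cov hi; [exists x2|].
by case: (hhi _ Sx).
Qed.

(** The whole box lies in the level set of [v] iff the minimum [lo] reaches [v], and the box meets
    it iff the maximum [hi] does. *)
Lemma level_expr (v : xfloat) : exists e, wf_expr e /\
  forall a b lo hi, float_box a b -> range_on a b lo hi ->
    itv_eval (box_itv a b) e = truth_itv (xle v lo) (xle v hi).
Proof.
have [e [we he]] := set_expr (fun x => xle v (p x)).
exists e; split=> // a b lo hi hab [[x1 [b1 e1]] [h1 [[x2 [b2 e2]] h2]]].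
rewrite he //; apply: truth_itv_ext; split.
- by move=> h; rewrite -e1; apply: h.
- by move=> h x hx; apply: xle_trans h (h1 x hx).
- by move=> [x [hx h]]; apply: xle_trans h (h2 x hx).
- by move=> h; exists x2; rewrite e2.
Qed.

Lemma range_xle (a b : 'I_n -> R) (lo hi : xfloat) : float_box a b -> range_on a b lo hi ->
  xle lo hi /\ in_Fbar E M lo /\ in_Fbar E M hi.
Proof.
move=> hab [[x1 [b1 <-]] [h1 [[x2 [b2 <-]] h2]]]; split; first exact: h1.
split; [have [] := @p_Fbar x1 | have [] := @p_Fbar x2] => // i; [by case: (b1 i) | by case: (b2 i)].
Qed.

(** The start of the telescoping sum: [Omega - Omega - Omega] gives [- Omega], whereas
    [0 - Omega - Omega] overflows to [MInf]. *)
Lemma clamp_bottom (y : xfloat) : y <> NaN -> in_Fbar E M y ->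
  fadd E M (fadd E M (Fin (Omega E M * ind (xle (Fin (- Omega E M)) y))) (Fin (- Omega E M)))
    (Fin (- Omega E M)) = xmin y (Fin (- Omega E M)).
Proof.
have o1 := in_F_opp Omega_inF; have [_ o2] := rnd_double_Omega.
have step (h : xle (Fin (- Omega E M)) y) :
    fadd E M (fadd E M (Fin (Omega E M * ind (xle (Fin (- Omega E M)) y))) (Fin (- Omega E M)))
    (Fin (- Omega E M)) = Fin (- Omega E M).
  rewrite ind_true // Rmult_1_r /=.
  have -> : Omega E M + - Omega E M = 0 by ring.
  by rewrite (rnd_id in_F0) /= Rplus_0_l rnd_id.
move=> ny hy; case: y ny hy step => [r| | |] //= _ hy step.
- have h := in_F_bound hy; rewrite step; last lra.
  by rewrite Rmin_right //; lra.
- exact: step.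
- by rewrite ind_false // Rmult_0_r Rplus_0_l rnd_id.
Qed.

(** Since no float lies strictly between [u] and [v], a finite [y] below [v] is at most [u] and is
    left alone; otherwise the clamped value is [u] and moves exactly to [v]. [MInf] absorbs the
    increment. *)
Lemma clamp_step (u v : R) (y : xfloat) : in_F E M u -> in_F E M v -> u < v ->
  (forall h, in_F E M h -> ~ (u < h < v)) -> y <> NaN -> in_Fbar E M y ->
  fadd E M (xmin y (Fin u)) (Fin ((v - u) * ind (xle (Fin v) y))) = xmin y (Fin v).
Proof.
move=> hu hv uv adj; case: y => [r| | |] //= _ hy.
- case: (Rle_dec v r) => h.
    rewrite ind_true // Rmin_right; last lra.
    by rewrite Rmin_right // Rmult_1_r; have -> : u + (v - u) = v by [ring]; rewrite rnd_id.
  rewrite ind_false // Rmin_left; last by have := adj r hy; lra.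
  by rewrite Rmult_0_r Rplus_0_r rnd_id // Rmin_left //; lra.
- rewrite ind_true // Rmult_1_r; have -> : u + (v - u) = v by ring.
  by rewrite rnd_id.
Qed.

(** Only for [y = PInf] is [Omega] added to the clamped value [Omega], which overflows; in the other
    cases zero is added. *)
Lemma clamp_top (y : xfloat) : y <> NaN -> in_Fbar E M y ->
  fadd E M (xmin y (Fin (Omega E M))) (Fin (Omega E M * ind (xle PInf y))) = y.
Proof.
have [o1 _] := rnd_double_Omega.
case: y => [r| | |] //= _ hy.
- have := in_F_bound hy; rewrite ind_false // => h.
  by rewrite Rmin_left ?Rmult_0_r ?Rplus_0_r ?rnd_id //; lra.
- by rewrite ind_true // Rmult_1_r.
Qed.

Lemma xmin_mono (x y : xfloat) (v : R) : xle x y -> xle (xmin x (Fin v)) (xmin y (Fin v)).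
Proof.
case: x => [a| | |]; case: y => [b| | |] //= h; try lra.
- by apply: Rle_min_compat_r.
- exact: Rmin_r.
Qed.

Lemma predecessor (v : R) : in_F E M v -> - Omega E M < v ->
  exists u, in_F E M u /\ u < v /\ forall h, in_F E M h -> ~ (u < h < v).
Proof.
move=> hv vO.
have [u [[hu uv] hmax]] := @finite_min _ (fun x y => y <= x) flt_enum flt_count
  (fun u => in_F E M u /\ u < v) ltac:(move=> *; lra) ltac:(move=> *; lra)
  ltac:(by move=> x [hx _]; apply: flt_enum_onto)
  ltac:(by exists (- Omega E M); split=> //; apply: in_F_opp; exact: Omega_inF).
by exists u; split=> //; split=> // h hh [uh hv']; have := hmax h (conj hh hv'); lra.
Qed.

(** Both summands depend on the same output, yet no precision is lost: each is nondecreasing in it,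
    so the lower ends both come from [lo] and the upper ends from [hi]. *)
Lemma add_level_sem (a b : 'I_n -> R) (lo hi y : xfloat) (e l : expr) (u w : R) :
  float_box a b -> range_on a b lo hi -> in_F E M w -> 0 <= w ->
  itv_eval (box_itv a b) e = Itv (xmin lo (Fin u)) (xmin hi (Fin u)) ->
  itv_eval (box_itv a b) l = truth_itv (xle y lo) (xle y hi) ->
  itv_eval (box_itv a b) (EOp OAdd e (EOp OMul (ECst w) l)) =
    Itv (fadd E M (xmin lo (Fin u)) (Fin (w * ind (xle y lo))))
        (fadd E M (xmin hi (Fin u)) (Fin (w * ind (xle y hi)))).
Proof.
move=> hab hr hw w0 ee el; have [lohi _] := range_xle hab hr.
have mono : xle y lo -> xle y hi by move=> h; apply: xle_trans h lohi.
have := scaled_expr_sem mono hw w0 el => /= ->; rewrite ee.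
apply: itv_add_fin; first exact: xmin_mono.
by have := ind_le mono; nra.
Qed.

(* The telescoping sum over consecutive floats: each partial sum is the output clamped from above,
   and every increment [v - u] is itself a float. *)
Lemma clamp_expr (v : R) : in_F E M v -> exists e, wf_expr e /\
  forall a b lo hi, float_box a b -> range_on a b lo hi ->
    itv_eval (box_itv a b) e = Itv (xmin lo (Fin v)) (xmin hi (Fin v)).
Proof.
have e0 := eta_gt0; have o0 := Omega_gt0.
have hO := Omega_inF; have hO' := in_F_opp hO.
have base : exists e, wf_expr e /\ forall a b lo hi, float_box a b -> range_on a b lo hi ->
    itv_eval (box_itv a b) e = Itv (xmin lo (Fin (- Omega E M))) (xmin hi (Fin (- Omega E M))).
  have [l [wl hl]] := level_expr (Fin (- Omega E M)).
  exists (chain_expr (EOp OMul (ECst (Omega E M)) l) [:: (OAdd, - Omega E M); (OAdd, - Omega E M)]).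
  split=> // a b lo hi hab hr; have [lohi [Flo Fhi]] := range_xle hab hr.
  have [nlo nhi] := xle_neq_nan lohi.
  have mono : xle (Fin (- Omega E M)) lo -> xle (Fin (- Omega E M)) hi.
    by move=> h; apply: xle_trans h lohi.
  rewrite (chain_expr_sem _ _ (scaled_expr_sem mono hO _ (hl _ _ _ _ hab hr))); try lra.
  - by rewrite /chain /= /chain_step /= -!clamp_bottom.
  - by do 2 (constructor; first by split).
  - by apply: Rmult_le_compat_l; [lra | case: (ind_le mono)].
(* The induction runs on a bound for the distance from [- Omega] in units of [eta]; passing to the
   predecessor reduces this distance by at least one unit. *)
move=> hv; have [k hk] : exists k : nat, v + Omega E M <= INR k * eta.
  have [k [_ ->]] := (in_FP v).1 hv; exists (Z.to_nat (k + Omega_int)).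
  rewrite OmegaE -Rmult_plus_distr_r -plus_IZR; apply/eta_le.
  by rewrite INR_IZR_INZ; apply: IZR_le; lia.
have bv := in_F_bound hv.
elim: k v hv bv hk => [|k IH] v hv bv hk; case: (Rle_lt_dec v (- Omega E M)) => hvO.
- by have -> : v = - Omega E M by lra.
- by exfalso; move: hk; rewrite /= ; lra.
- by have -> : v = - Omega E M by lra.
have [u [hu [uv adj]]] := predecessor hv hvO.
have [hd _] := adjacent_flt hu hv uv adj.
have ge := eta_le_inF hd ltac:(lra).
have [|e [we he]] := IH u hu (in_F_bound hu); first by move: hk; rewrite S_INR; lra.
have [l [wl hl]] := level_expr (Fin v).
exists (EOp OAdd e (EOp OMul (ECst (v - u)) l)); split=> // a b lo hi hab hr.
have [lohi [Flo Fhi]] := range_xle hab hr; have [nlo nhi] := xle_neq_nan lohi.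
rewrite (add_level_sem hab hr hd _ (he _ _ _ _ hab hr) (hl _ _ _ _ hab hr)); last lra.
by rewrite !clamp_step.
Qed.

Lemma range_expr : exists e, wf_expr e /\
  forall a b lo hi, float_box a b -> range_on a b lo hi -> itv_eval (box_itv a b) e = Itv lo hi.
Proof.
have [e [we he]] := clamp_expr Omega_inF; have [l [wl hl]] := level_expr PInf.
exists (EOp OAdd e (EOp OMul (ECst (Omega E M)) l)); split.
  by split=> //; split=> //; exact: Omega_inF.
move=> a b lo hi hab hr.
have [lohi [Flo Fhi]] := range_xle hab hr; have [nlo nhi] := xle_neq_nan lohi.
rewrite (add_level_sem hab hr Omega_inF _ (he _ _ _ _ hab hr) (hl _ _ _ _ hab hr)).
  by rewrite !clamp_top.
by have := Omega_gt0; lra.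
Qed.
End Output.

(** * Concrete semantics as interval semantics on degenerate boxes *)

Definition point_itv (y : xfloat) : itv := if is_nan y then Top else Itv y y.

(** On singletons all four corners coincide, and a [NaN] corner gives [Top], the image of [NaN]. *)
Lemma point_itv_op (o : fop) (y z : xfloat) :
  itv_op (fop_sem E M o) (point_itv y) (point_itv z) = point_itv (fop_sem E M o y z).
Proof.
have nan t : is_nan t = true -> t = NaN by case: t.
rewrite /point_itv; case ny: (is_nan y); first by rewrite (nan _ ny); case: o.
case nz: (is_nan z); first by rewrite (nan _ nz); case: o; case: y ny.
rewrite /= !orbb; case nf: (is_nan _) => //.
have h : xle (fop_sem E M o y z) (fop_sem E M o y z).
  by apply: xle_refl => e; rewrite e in nf.
by rewrite (xmin_l h) (xmax_r h) (xmin_l h) (xmax_r h).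
Qed.

Lemma run_point (x : 'I_n -> R) (l : list instr) (env : list xfloat) :
  run_itv (fun i => point_itv (Fin (x i))) l [seq point_itv y | y <- env] =
  [seq point_itv y | y <- run (fop_sem E M) (fun i => Fin (x i)) Fin NaN l env].
Proof.
have tm (env' : list xfloat) t : eval_itv (fun i => point_itv (Fin (x i))) (map point_itv env') t =
    point_itv (eval_term (fun i => Fin (x i)) Fin NaN env' t).
  case: t => //= k; rewrite !nth_nthE.
  case: (ltnP k (size env')) => hk; first by rewrite (nth_map NaN).
  (* Beyond the environment the defaults agree, because [point_itv NaN] is [Top]. *)
  by rewrite !nth_default ?size_map.
elim: l env => //= -[[o u] u'] l IH env.
by rewrite !tm point_itv_op -IH map_cat.
Qed.

Lemma sem_point (k : nat) (Q : slp n k) (x : 'I_n -> R) (j : 'I_k) :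
  itv_sem E M Q (box_itv x x) j = point_itv (conc_sem E M Q x j).
Proof.
rewrite /itv_sem /conc_sem /sem (run_point x (assigns Q) [::]).
case: (outs Q j) => //= v; rewrite !nth_nthE.
set env := run _ _ _ _ _ _.
case: (ltnP v (size env)) => hk; first by rewrite (nth_map NaN).
by rewrite !nth_default ?size_map.
Qed.
End Expressions.
End Floats.

(** * One program for all outputs, exact on finite boxes and on points *)

Theorem theorem3 (E M : nat) (hE : (5 <= E)%coq_nat) (hM3 : (3 <= M)%coq_nat)
  (hM : (Z.of_nat M <= 2 ^ (Z.of_nat E - 1))%Z)
  (n m : nat) (P : ('I_n -> R) -> 'I_m -> xfloat)
  (hP : forall x : 'I_n -> R, (forall i, in_F E M (x i)) ->
          forall j, in_Fbar E M (P x j) /\ P x j <> NaN) :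
  exists Q : slp n m,
    wf_slp E M Q /\
    (forall B : 'I_n -> itv,
       (forall i, valid_itv E M (B i)) ->
       (forall y : 'I_n -> xfloat, (forall i, in_gamma E M (B i) (y i)) ->
          forall i, exists r, y i = Fin r /\ in_F E M r) ->
       forall j : 'I_m,
       exists lo hi : xfloat,
         (exists x : 'I_n -> R, (forall i, in_gamma E M (B i) (Fin (x i))) /\ P x j = lo) /\
         (forall x : 'I_n -> R, (forall i, in_gamma E M (B i) (Fin (x i))) -> xle lo (P x j)) /\
         (exists x : 'I_n -> R, (forall i, in_gamma E M (B i) (Fin (x i))) /\ P x j = hi) /\
         (forall x : 'I_n -> R, (forall i, in_gamma E M (B i) (Fin (x i))) -> xle (P x j) hi) /\
         (forall y : xfloat,
            in_gamma E M (itv_sem E M Q B j) y <-> (in_Fbar E M y /\ xle lo y /\ xle y hi))) /\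
    (forall x : 'I_n -> R, (forall i, in_F E M (x i)) ->
       forall j, conc_sem E M Q x j = P x j).
Proof.
have [es hes] : exists es : 'I_m -> expr n, forall j, wf_expr E M (es j) /\
    forall a b lo hi, float_box E M a b -> range_on E M (P^~ j) a b lo hi ->
      itv_eval E M (box_itv a b) (es j) = Itv lo hi.
  apply: (@fin_all_exists _ (fun=> expr n) (fun j e => wf_expr E M e /\ forall a b lo hi,
    float_box E M a b -> range_on E M (P^~ j) a b lo hi ->
    itv_eval E M (box_itv a b) e = Itv lo hi)).
  by move=> j; apply: range_expr => // x hx; apply: hP.
(* The family over ['I_m] is extended to [nat] by a dummy constant, as [compile_all] expects. *)
pose es' k := if insub k is Some j then es j else ECst n R0.
have wf' k : wf_expr E M (es' k).
  by rewrite /es'; case: insub => [j|]; [case: (hes j) | exact: in_F0].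
have [l [ts [w1 [w2 hl]]]] := compile_all m wf'.
pose Q := SLP l (fun j : 'I_m => ts j).
have semQ B j : itv_sem E M Q B j = itv_eval E M B (es j).
  have [_ /(_ j [::] (ltn_ord j))] := hl B.
  by rewrite cats0 /es' valK.
have exact_box a b j : float_box E M a b -> exists lo hi, range_on E M (P^~ j) a b lo hi /\
    itv_sem E M Q (box_itv a b) j = Itv lo hi.
  move=> hab; have [lo [hi hr]] : exists lo hi, range_on E M (P^~ j) a b lo hi.
    by apply: range_exists => // x hx; apply: hP.
  by exists lo, hi; split=> //; rewrite semQ; apply: (hes j).2.
exists Q; split; first by split=> // j; apply: w2.
split=> [B hB hfin j|x hx j].
  have hend (y : 'I_n -> xfloat) :
      (forall i, in_gamma E M (B i) (y i)) -> forall i, exists r, y i = Fin r.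
    by move=> hy i; have [r [-> _]] := hfin y hy i; exists r.
  (* The endpoints belong to the box, hence are finite. For [Top] the witness is [NaN], whose
     membership contradicts finiteness. *)
  have hi_in i : in_gamma E M (B i) (if B i is Itv _ b then b else NaN).
    by have := hB i; case: (B i) => //= c d [h1 [h2 [h3 [h4 h5]]]];
      do 2 (split=> //); apply: xle_refl.
  have lo_in i : in_gamma E M (B i) (if B i is Itv a _ then a else NaN).
    by have := hB i; case: (B i) => //= c d [h1 [h2 [h3 [h4 h5]]]];
      do 2 (split=> //); apply: xle_refl.
  have [a ha] := fin_all_exists (hend _ lo_in); have [b hb] := fin_all_exists (hend _ hi_in).
  have eB : B = box_itv a b.
    apply: functional_extensionality => i; have := ha i; have := hb i.
    by rewrite /box_itv; case: (B i) => // c d -> ->.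
  have hab : float_box E M a b.
    by move=> i; have := hB i; rewrite eB /= => -[h1 [h2 [_ [_ h3]]]].
  have [lo [hi [[r1 [r2 [r3 r4]]] e]]] := exact_box a b j hab.
  have box_gamma x : (forall i, in_gamma E M (B i) (Fin (x i))) <-> in_box E M a b x.
    by rewrite eB.
  exists lo, hi; split; first by have [x [hx ex]] := r1; exists x; split=> //; apply/box_gamma.
  split; first by move=> x /box_gamma /r2.
  split; first by have [x [hx ex]] := r3; exists x; split=> //; apply/box_gamma.
  split; first by move=> x /box_gamma /r4.
  by move=> y; rewrite eB e.
(* On the degenerate box at [x], minimum and maximum are both [P x j]. *)
have hxx : float_box E M x x by move=> i; split=> //; split=> //; apply: Rle_refl.
have [lo [hi [[hlo [_ [hhi _]]]]]] := exact_box x x j hxx.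
move: hlo hhi => [y1 [/in_point_box -> <-]] [y2 [/in_point_box -> <-]].
by rewrite sem_point /point_itv; case: is_nan => // -[].
Qed.
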